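(* Let $I$ be a set and $1 \leq p < \infty$. (1) The pre-annihilator $(\mathfrak{M}_{p,cb}^{I})_{\perp}\subset S_p^{I}\widehat{\otimes}S_{p^*}^{I}$ of the space $\mathfrak{M}_{p,cb}^{I}\subset CB(S_p^I)$ of completely bounded Schur multipliers on $S_p^{I}$ is equal to $\mathrm{Ker}\,\psi_p^{I}$. Moreover, there is a complete isometry $\mathfrak{M}_{p,cb}^{I}=\big((S_p^{I}\widehat{\otimes}S_{p^*}^{I})/\mathrm{Ker}\,\psi_p^{I}\big)^*$. (2) The pre-annihilator $(\mathfrak{M}_{p}^{I})_{\perp}\subset S_p^{I}\otimes_\gamma S_{p^*}^{I}$ of the space $\mathfrak{M}_{p}^{I}\subset B(S_p^I)$ of bounded Schur multipliers on $S_p^{I}$ is equal to $\mathrm{Ker}\,\varphi_p^{I}$. Moreover, there is an isometry $\mathfrak{M}_{p}^{I}=\big((S_{p}^{I}\otimes_\gamma S_{p^*}^{I})/\mathrm{Ker}\,\varphi_{p}^{I}\big)^*$.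
   Context: For $1\le p<\infty$, $S_p^I$ is the Schatten class of compact operators $A$ on $\ell_2^I$ with $\|A\|_{S_p^I}=(\mathrm{Tr}\,(A^*A)^{p/2})^{1/p}<\infty$; $S_\infty^I$ is the space of compact operators on $\ell_2^I$ with the operator norm. Elements are regarded as $I\times I$ matrices. $p^*$ is the conjugate exponent. Duality pairing: $\langle A,B\rangle_{S_p^I,S_{p^*}^I}=\mathrm{Tr}(AB^T)$, with $B^T$ the matrix transpose. Operator space structures: $S_\infty^I$ has its $C^*$-algebra structure, $S_1^I$ is the dual of $S_\infty^I$ (via the pairing $\langle A,B\rangle_{S_1^I,S_\infty^I}=\mathrm{Tr}(AB^T)$), and $S_p^I=(S_\infty^I,S_1^I)_{1/p}$ by complex interpolation, with $M_n(E_\theta)=(M_n(E_0),M_n(E_1))_\theta$. $*$ is the Schur (entrywise) product $[a_{ij}]*[b_{ij}]=[a_{ij}b_{ij}]$. A matrix $A$ defines a Schur multiplier $M_A$ on $S_p^I$ if $M_A(B)=A*B\in S_p^I$ for all $B\in S_p^I$ (then $M_A$ is bounded). $\mathfrak{M}_p^I\subset B(S_p^I)$ is the space of bounded Schur multipliers, and $\mathfrak{M}_{p,cb}^I\subset CB(S_p^I)$ the space of completely bounded ones, with the norm, respectively operator space structure, inherited from $B(S_p^I)$, respectively $CB(S_p^I)$. $\widehat{\otimes}$ is the operator space projective tensor product and $\otimes_\gamma$ the Banach space projective tensor product. One has $(S_p^I\widehat{\otimes}S_{p^*}^I)^*=CB(S_p^I)$ completely isometrically and $(S_p^I\otimes_\gamma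 S_{p^*}^I)^*=B(S_p^I)$ isometrically, both via $\langle T,A\otimes B\rangle=\langle T(A),B\rangle_{S_p^I,S_{p^*}^I}$; pre-annihilators are taken, and the identifications of $\mathfrak{M}_{p,cb}^I$ and $\mathfrak{M}_p^I$ with duals are induced, with respect to these pairings. $\psi_p^I: S_p^I\widehat{\otimes}S_{p^*}^I\to S_1^I$ is the completely contractive linear map with $\psi_p^I(A\otimes B)=A*B$, and $\varphi_p^I: S_p^I\otimes_\gamma S_{p^*}^I\to S_1^I$ is the contractive linear map with $\varphi_p^I(A\otimes B)=A*B$. *)

(* Defs.v *)
From HB Require Import structures.
From mathcomp Require Import all_boot all_order all_algebra generic_quotient complex.
From mathcomp Require Import finmap all_classical all_reals all_analysis.
From mathcomp Require summability.

Set Implicit Arguments.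
Unset Strict Implicit.
Unset Printing Implicit Defensive.

Import Order.TTheory GRing.Theory Num.Theory.
Import numFieldNormedType.Exports.

Local Open Scope classical_set_scope.
Local Open Scope ring_scope.

Local Notation Re := complex.Re.

Section QuotientByKernel.
Local Open Scope quotient_scope.
Variables (K : pzRingType) (V W : lmodType K) (f : {linear V -> W}).

(* f x = f y iff x - y \in Ker f: the classes are the cosets of Ker f. *)
Definition ker_rel (x y : V) : bool := `[< f x = f y >].

Lemma ker_rel_refl : reflexive ker_rel.
Proof. by move=> x; apply/asboolP. Qed.
Lemma ker_rel_sym : symmetric ker_rel.
Proof. by move=> x y; apply/asboolP/asboolP. Qed.
Lemma ker_rel_trans : transitive ker_rel.
Proof. by move=> y x z /asboolP xy /asboolP yz; apply/asboolP; rewrite xy. Qed.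

Canonical ker_equiv := EquivRel ker_rel ker_rel_refl ker_rel_sym ker_rel_trans.

Definition quot_ker := {eq_quot ker_equiv}.
HB.instance Definition _ := Choice.on quot_ker.
HB.instance Definition _ := EqQuotient.on quot_ker.

Lemma quot_kerP x y : (\pi_quot_ker x = \pi_quot_ker y) <-> f x = f y.
Proof.
by split=> [/eqP|xy]; [rewrite eqmodE => /asboolP|apply/eqP; rewrite eqmodE; apply/asboolP].
Qed.

Lemma f_repr (x : V) : f (repr (\pi_quot_ker x)) = f x.
Proof. by apply/quot_kerP; rewrite reprK. Qed.

Definition qadd (p q : quot_ker) : quot_ker := \pi_quot_ker (repr p + repr q).
Definition qopp (p : quot_ker) : quot_ker := \pi_quot_ker (- repr p).
Definition qscale (a : K) (p : quot_ker) : quot_ker := \pi_quot_ker (a *: repr p).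

Lemma qaddA : associative qadd.
Proof.
move=> p q r; apply/quot_kerP.
by rewrite !linearD /= !f_repr !linearD /= addrA.
Qed.
Lemma qaddC : commutative qadd.
Proof. by move=> p q; rewrite /qadd addrC. Qed.
Lemma qadd0 : left_id (\pi_quot_ker 0) qadd.
Proof.
move=> p; rewrite -[RHS]reprK; apply/quot_kerP.
by rewrite linearD /= f_repr linear0 add0r.
Qed.
Lemma qaddN : left_inverse (\pi_quot_ker 0) qopp qadd.
Proof.
move=> p; apply/quot_kerP.
by rewrite linearD /= f_repr linearN addNr linear0.
Qed.

HB.instance Definition _ := GRing.isZmodule.Build quot_ker qaddA qaddC qadd0 qaddN.

Lemma qscaleA a b p : qscale a (qscale b p) = qscale (a * b) p.
Proof. by apply/quot_kerP; rewrite !linearZ /= f_repr linearZ /= scalerA. Qed.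
Lemma qscale1 : left_id 1 qscale.
Proof. by move=> p; rewrite -[RHS]reprK; apply/quot_kerP; rewrite scale1r. Qed.
Lemma qscaleDr : right_distributive qscale +%R.
Proof.
move=> a p q; apply/quot_kerP.
by rewrite !linearZ /= f_repr !linearD /= !f_repr !linearZ /= scalerDr.
Qed.
Lemma qscaleDl p : {morph qscale^~ p : a b / a + b}.
Proof.
move=> a b; apply/quot_kerP.
by rewrite linearZ /= linearD /= !f_repr !linearZ /= scalerDl.
Qed.

HB.instance Definition _ :=
  GRing.Zmodule_isLmodule.Build K quot_ker qscaleA qscale1 qscaleDr qscaleDl.

Definition quot_pi (x : V) : quot_ker := \pi_quot_ker x.

Lemma quot_pi_linear : linear quot_pi.
Proof.
move=> a x y; apply/quot_kerP.
by rewrite linearP /= linearD /= !f_repr linearZ /= f_repr.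
Qed.

HB.instance Definition _ :=
  GRing.isLinear.Build K V quot_ker *:%R quot_pi quot_pi_linear.

End QuotientByKernel.

Section Operators.
Variable R : realType.
Local Notation C := R[i].

Definition rnorm (V : normedModType C) (x : V) : R := Re `|x|.
Definition cmod (z : C) : R := Re `|z|.

(* Unconditional sums: limits of the net of finite partial sums. *)
Definition csum (J : choiceType) (x : J -> C) : C :=
  summability.sum (x : J -> C^o).
Definition csummable (J : choiceType) (x : J -> C) : Prop :=
  cvg (summability.partial_sum (x : J -> C^o) @ summability.totally).

Definition l2norm (J : choiceType) (x : J -> C) : \bar R :=
  ((\esum_(j in [set: J]) (cmod (x j) ^+ 2)%:E) `^ (2^-1))%E.
Definition l2 (J : choiceType) : set (J -> C) := [set x | (l2norm x < +oo)%E].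
Definition inner (J : choiceType) (x y : J -> C) : C :=
  csum (fun j => x j * (y j)^*).

(* J x K matrices, as operators from l2^K to l2^J. *)
Definition mulv (J K : choiceType) (A : J -> K -> C) (x : K -> C) : J -> C :=
  fun j => csum (fun k => A j k * x k).
Definition mulop (J K L : choiceType) (A : J -> K -> C) (B : K -> L -> C) :
  J -> L -> C := fun j l => csum (fun k => A j k * B k l).
Definition trmat (J K : Type) (A : J -> K -> C) : K -> J -> C :=
  fun k j => A j k.
Definition adj (J K : Type) (A : J -> K -> C) : K -> J -> C :=
  fun k j => (A j k)^*.
Definition trace (J : choiceType) (A : J -> J -> C) : C :=
  csum (fun j => A j j).

(* +oo when A does not act on l2^K; without the first clause the sums in mulv
   could be meaningless limits. *)
Definition opnorm (J K : choiceType) (A : J -> K -> C) : \bar R :=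
  if `[< forall x j, l2 x -> csummable (fun k => A j k * x k) >]
  then ereal_sup [set l2norm (mulv A x) | x in [set x | (l2norm x <= 1)%E]]
  else +oo%E.

Definition compact_op (J K : choiceType) (A : J -> K -> C) : Prop :=
  (opnorm A < +oo)%E /\
  forall x : nat -> K -> C, (forall n, (l2norm (x n) <= 1)%E) ->
  exists (s : nat -> nat) (y : J -> C),
    [/\ {homo s : m n / (m < n)%N}, l2 y &
        (fun n => l2norm (mulv A (x (s n)) - y)) @ \oo --> 0%E].

Definition orthonormal_basis (J : choiceType) (b : J -> J -> C) : Prop :=
  [/\ forall k, l2 (b k),
      forall k l, inner (b k) (b l) = (k == l)%:R &
      forall x, l2 x -> (forall k, inner x (b k) = 0) -> x = 0].

(* P = H ^ r for a positive diagonalizable operator H, by functional calculus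
   in an orthonormal basis of eigenvectors. *)
Definition op_power (J : choiceType) (H : J -> J -> C) (r : R)
    (P : J -> J -> C) : Prop :=
  (opnorm P < +oo)%E /\
  exists (b : J -> J -> C) (lam : J -> R),
    [/\ orthonormal_basis b, forall k, 0 <= lam k,
        forall k, mulv H (b k) = (lam k)%:C%C *: b k &
        forall k, mulv P (b k) = (lam k `^ r)%:C%C *: b k].

(* Tr ((A^* A)^(p/2)) in [0, +oo]; there is exactly one P when A is compact,
   so that the infimum merely selects its trace. *)
Definition schatten_trace (J : choiceType) (p : R) (A : J -> J -> C) : \bar R :=
  ereal_inf [set (\esum_(j in [set: J]) (Re (P j j))%:E)%E
            | P in op_power (mulop (adj A) A) (p / 2)].

Definition schatten_norm (J : choiceType) (p : \bar R) (A : J -> J -> C) :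
    \bar R :=
  match p with
  | r%:E => (schatten_trace r A `^ r^-1)%E
  | _ => opnorm A
  end.

Definition schatten (J : choiceType) (p : \bar R) : set (J -> J -> C) :=
  [set A | compact_op A /\ (schatten_norm p A < +oo)%E].

Definition pairing (J : choiceType) (A B : J -> J -> C) : C :=
  trace (mulop A (trmat B)).

Definition schur (J : Type) (A B : J -> J -> C) : J -> J -> C :=
  fun i j => A i j * B i j.

End Operators.

(* Normed spaces and matricially normed spaces presented as a subset of an
   ambient vector space, with norms that are meaningful on that subset only.
   M_n(E) is generalized to M_J(E) with J any finite index set, which spares
   the re-indexings M_m(M_n(E)) = M_mn(E). *)
Section Spaces.
Variable R : realType.
Local Notation C := R[i].

Record nspace := NSpace {
  ncar :> lmodType C;
  ndom : set ncar;
  nnorm : ncar -> \bar R }.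

Record mspace := MSpace {
  mcar :> lmodType C;
  mdom : set mcar;
  mnorm : forall J : finType, (J -> J -> mcar) -> \bar R }.

Definition mdomM (E : mspace) (J : finType) : set (J -> J -> E) :=
  [set x | forall i j, mdom (x i j)].

Definition linear_on (V W : lmodType C) (D : set V) (f : V -> W) : Prop :=
  forall a x y, D x -> D y -> D (a *: x + y) ->
  f (a *: x + y) = a *: f x + f y.

(* D is a subspace in every use, so that the third premise of linear_on is
   redundant. Linear maps D -> D' are extended by 0 outside D so that equality of functions
   is equality on D. *)
Definition lmaps (V W : lmodType C) (D : set V) (D' : set W) :
    set (V -> W) :=
  [set f | [/\ linear_on D f, forall x, D x -> D' (f x) &
               forall x, ~ D x -> f x = 0]].

Definition bnorm (E F : nspace) (f : E -> F) : \bar R :=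
  ereal_sup [set nnorm (f x)
            | x in [set x | @ndom E x /\ (nnorm x <= 1)%E]].

Definition Bspace (E F : nspace) : nspace :=
  @NSpace (E -> F)
    [set f | lmaps (@ndom E) (@ndom F) f /\ (bnorm f < +oo)%E]
    (@bnorm E F).

(* The norm of M_J(CB(E, F)) = CB(E, M_J(F)). *)
Definition cbnorm (E F : mspace) (J : finType) (f : J -> J -> E -> F) :
    \bar R :=
  ereal_sup [set r | exists (K : finType) (x : K -> K -> E),
    [/\ mdomM x, (mnorm x <= 1)%E &
        r = mnorm (fun a b : K * J => f a.2 b.2 (x a.1 b.1))]].

Definition CBspace (E F : mspace) : mspace :=
  @MSpace (E -> F)
    [set f | lmaps (@mdom E) (@mdom F) f /\
             (cbnorm (fun _ _ : unit => f) < +oo)%E]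
    (@cbnorm E F).

Definition nscalars : nspace := @NSpace C^o setT (fun z => (cmod z)%:E).
Definition mscalars : mspace := @MSpace C^o setT (fun J a => opnorm a).

Definition ndual (E : nspace) : nspace := Bspace E nscalars.
Definition mdual (E : mspace) : mspace := CBspace E mscalars.

Definition nsub (E : nspace) (D : set E) : nspace :=
  @NSpace E (@ndom E `&` D) (@nnorm E).
Definition msub (E : mspace) (D : set E) : mspace :=
  @MSpace E (@mdom E `&` D) (@mnorm E).

Definition nquot (E : nspace) (W : lmodType C) (f : {linear E -> W}) : nspace :=
  @NSpace (quot_ker f) [set quot_pi f x | x in @ndom E]
    (fun q => ereal_inf [set nnorm x
                        | x in [set x | @ndom E x /\ quot_pi f x = q]]).
Definition mquot (E : mspace) (W : lmodType C) (f : {linear E -> W}) : mspace :=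
  @MSpace (quot_ker f) [set quot_pi f x | x in @mdom E]
    (fun J q => ereal_inf [set mnorm x
      | x in [set x : J -> J -> E |
               mdomM x /\ forall i j, quot_pi f (x i j) = q i j]]).

Definition isometric_iso (E F : nspace) (f : E -> F) : Prop :=
  [/\ linear_on (@ndom E) f,
      forall x, ndom x -> ndom (f x),
      forall y, @ndom F y -> exists2 x, ndom x & f x = y &
      forall x, ndom x -> nnorm (f x) = nnorm x].

Definition complete_isometric_iso (E F : mspace) (f : E -> F) : Prop :=
  [/\ linear_on (@mdom E) f,
      forall x, mdom x -> mdom (f x),
      forall y, @mdom F y -> exists2 x, mdom x & f x = y &
      forall (J : finType) (x : J -> J -> E), mdomM x ->
        mnorm (fun i j => f (x i j)) = mnorm x].

Definition contractive (E F : nspace) (f : E -> F) : Prop :=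
  forall x, ndom x -> ndom (f x) /\ (nnorm (f x) <= nnorm x)%E.

Definition completely_contractive (E F : mspace) (f : E -> F) : Prop :=
  (forall x, mdom x -> mdom (f x)) /\
  forall (J : finType) (x : J -> J -> E), mdomM x ->
    (mnorm (fun i j => f (x i j)) <= mnorm x)%E.

Definition banach (X : completeNormedModType C) : nspace :=
  @NSpace X setT (fun x => (rnorm x)%:E).

Definition mxmul3 (V : lmodType C) (J K L : finType)
    (al : J -> K -> C) (x : K -> L -> V) (be : L -> J -> C) : J -> J -> V :=
  fun i j => \sum_k \sum_l (al i k * be l j) *: x k l.

Definition dsum (V : lmodType C) (J K : finType)
    (x : J -> J -> V) (y : K -> K -> V) : J + K -> J + K -> V :=
  fun a b => match a, b with
             | inl i, inl j => x i j
             | inr i, inr j => y i j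
             | _, _ => 0
             end.

(* Ruan's axioms for matrix norms on a Banach space X. *)
Definition operator_space (X : completeNormedModType C)
    (N : forall J : finType, (J -> J -> X) -> R) : Prop :=
  [/\ forall x : X, N unit (fun _ _ => x) = rnorm x,
      forall (J : finType) (x y : J -> J -> X), N J (x + y) <= N J x + N J y,
      forall (J K : finType) (al : J -> K -> C) (x : K -> K -> X)
        (be : K -> J -> C),
        ((N J (mxmul3 al x be))%:E <= opnorm al * (N K x)%:E * opnorm be)%E &
      forall (J K : finType) (x : J -> J -> X) (y : K -> K -> X),
        N (J + K)%type (dsum x y) = Num.max (N J x) (N K y)].

Definition opspace (X : completeNormedModType C)
    (N : forall J : finType, (J -> J -> X) -> R) : mspace :=
  @MSpace X setT (fun J x => (N J x)%:E).

Section TensorProducts.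
Variables (V W : lmodType C) (D : set V) (D' : set W).
Variables (X : completeNormedModType C) (t : V -> W -> X).

Definition bilinear_on : Prop :=
  (forall y, D' y -> linear_on D (t^~ y)) /\
  (forall x, D x -> linear_on D' (t x)).

(* Together with bilinearity: t is injective on the algebraic tensor product. *)
Definition tensor_injective : Prop :=
  forall (n : nat) (x : 'I_n -> V) (y : 'I_n -> W),
    (forall k, D (x k)) -> (forall k, D' (y k)) ->
    (forall a : 'I_n -> C, \sum_k a k *: x k = 0 -> forall k, a k = 0) ->
    \sum_k t (x k) (y k) = 0 -> forall k, y k = 0.

Definition alg_tensors : set X :=
  [set u | exists (n : nat) (x : 'I_n -> V) (y : 'I_n -> W),
     [/\ forall k, D (x k), forall k, D' (y k) & u = \sum_k t (x k) (y k)]].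

End TensorProducts.

(* (X, t) is the completion of the algebraic tensor product of E and F for the
   Banach space projective norm. *)
Definition proj_tensor (E F : nspace) (X : completeNormedModType C)
    (t : E -> F -> X) : Prop :=
  [/\ bilinear_on (@ndom E) (@ndom F) t,
      tensor_injective (@ndom E) (@ndom F) t,
      closure (alg_tensors (@ndom E) (@ndom F) t) = setT &
      forall u, alg_tensors (@ndom E) (@ndom F) t u ->
        (rnorm u)%:E =
        ereal_inf [set r | exists (n : nat) (x : 'I_n -> E) (y : 'I_n -> F),
          [/\ forall k, ndom (x k), forall k, ndom (y k),
              u = \sum_k t (x k) (y k) &
              r = (\sum_k nnorm (x k) * nnorm (y k))%E]]].

(* (X, N, t) is the completion of the algebraic tensor product of E and F for
   the operator space projective matrix norms
     |u| = inf { |al| |x| |y| |be| : u = al (x (x) y) be }. *)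
Definition op_proj_tensor (E F : mspace) (X : completeNormedModType C)
    (N : forall J : finType, (J -> J -> X) -> R) (t : E -> F -> X) : Prop :=
  [/\ operator_space N /\ bilinear_on (@mdom E) (@mdom F) t,
      tensor_injective (@mdom E) (@mdom F) t,
      closure (alg_tensors (@mdom E) (@mdom F) t) = setT &
      forall (J : finType) (u : J -> J -> X),
        (forall i j, alg_tensors (@mdom E) (@mdom F) t (u i j)) ->
        (N J u)%:E =
        ereal_inf [set r | exists (K L : finType) (al : J -> K * L -> C)
            (x : K -> K -> E) (y : L -> L -> F) (be : K * L -> J -> C),
          [/\ mdomM x, mdomM y,
              u = mxmul3 al
                    (fun a b : K * L => t (x a.1 b.1) (y a.2 b.2)) be &
              r = (opnorm al * mnorm x * mnorm y * opnorm be)%E]]].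

(* Complex interpolation of two norms N0, N1 on subspaces of V, each +oo off
   its subspace. *)
Section Interpolation.
Variables (V : lmodType C) (N0 N1 : V -> \bar R).

Definition sumnorm (v : V) : \bar R :=
  ereal_inf [set (N0 a + N1 (v - a))%E | a in setT].

Definition strip : set C := [set z | 0 <= Re z <= 1].

Definition cont_on (T : C -> Prop) (N : V -> \bar R) (f : C -> V) : Prop :=
  forall z, T z -> forall e : R, 0 < e -> exists2 d : R, 0 < d &
  forall w, T w -> cmod (w - z) < d -> (N (f w - f z)%R <= e%:E)%E.

Definition bounded_on (T : C -> Prop) (N : V -> \bar R) (f : C -> V) : Prop :=
  exists M : R, forall z, T z -> (N (f z) <= M%:E)%E.

Definition holo_on_strip (f : C -> V) : Prop :=
  forall z, 0 < Re z < 1 -> exists v : V,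
  forall e : R, 0 < e -> exists2 d : R, 0 < d &
  forall w, w != z -> cmod (w - z) < d ->
    (sumnorm ((w - z)^-1 *: (f w - f z) - v)%R <= e%:E)%E.

Definition interp_fun (f : C -> V) : Prop :=
  [/\ bounded_on strip sumnorm f /\ cont_on strip sumnorm f,
      holo_on_strip f,
      bounded_on (fun z => Re z = 0) N0 f /\ cont_on (fun z => Re z = 0) N0 f &
      bounded_on (fun z => Re z = 1) N1 f /\ cont_on (fun z => Re z = 1) N1 f].

Definition interp_fun_norm (f : C -> V) : \bar R :=
  maxe (ereal_sup [set N0 (f z) | z in [set z | Re z = 0]])
       (ereal_sup [set N1 (f z) | z in [set z | Re z = 1]]).

Definition interp_norm (theta : R) (v : V) : \bar R :=
  ereal_inf [set interp_fun_norm f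
            | f in [set f | interp_fun f /\ f theta%:C%C = v]].

End Interpolation.

Definition mnorm_ext (E : mspace) (J : finType) (x : J -> J -> E) : \bar R :=
  if `[< mdomM x >] then mnorm x else +oo%E.

End Spaces.

Section SchattenSpaces.
Variables (R : realType) (I : choiceType).
Local Notation C := R[i].
Local Notation mat := (I -> I -> C).

Definition Schatten (p : \bar R) : nspace R :=
  @NSpace R mat (schatten p) (schatten_norm p).

(* M_J(S_oo) acts on l2^J (x) l2^I = l2^(J x I). *)
Definition opSchatten_oo : mspace R :=
  @MSpace R mat (schatten +oo%E)
    (fun J x => opnorm (fun a b : J * I => x a.1 b.1 a.2 b.2)).

Definition opSchatten_1 : mspace R :=
  @MSpace R mat (schatten 1%:E)
    (fun J x => @mnorm R (mdual opSchatten_oo) J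
                  (fun i j (B : mat) => pairing (x i j) B)).

(* (S_oo, S_1)_(1/p), read as S_oo and S_1 at the end points. *)
Definition opSchatten (p : \bar R) : mspace R :=
  @MSpace R mat (schatten p)
    (fun J x => match p with
     | r%:E => if r == 1 then @mnorm R opSchatten_1 J x
               else interp_norm (@mnorm_ext R opSchatten_oo J)
                                (@mnorm_ext R opSchatten_1 J) r^-1 x
     | _ => @mnorm R opSchatten_oo J x
     end).

Definition schur_multiplier (p : \bar R) (A : mat) : Prop :=
  forall B : mat, schatten p B -> schatten p (schur A B).

(* M_A, extended by 0 off S_p like the elements of lmaps. *)
Definition schur_map (p : \bar R) (A : mat) : mat -> mat :=
  fun B => if `[< schatten p B >] then schur A B else 0.

Definition schur_maps (p : \bar R) : set (mat -> mat) :=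
  [set T | exists2 A, schur_multiplier p A & T = schur_map p A].

Definition SchurM (p : \bar R) : nspace R :=
  @nsub R (Bspace (Schatten p) (Schatten p)) (schur_maps p).
Definition SchurMcb (p : \bar R) : mspace R :=
  @msub R (CBspace (opSchatten p) (opSchatten p)) (schur_maps p).

End SchattenSpaces.

(* Main.v *)
Require Import Defs.
From mathcomp Require Import all_boot all_order all_algebra generic_quotient complex.
From mathcomp Require Import finmap all_classical all_reals all_analysis.
From mathcomp Require summability.
From mathcomp Require Import ring lra.

(**
If T is the multiplier of a finitely supported matrix A, then Phi T u is the finite sum of
the a_ij psi(u)_ij: both sides are bounded functionals of u which agree on tensors. Hence it
suffices to approximate the multiplier of A pointwise on X by those of its finite truncations,
with a uniform bound. The truncation of A to a set of rows is the average of A and of A with the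
signs of the other rows changed, and changing the signs of rows and columns preserves all the
norms; no triangle inequality for the Schatten norms is needed, as the averages are taken in
X^* and pulled back along the surjection Phi. The boundedness of the truncations of
sum_ij a_ij b_ij d_ij gives the convergence of this iterated sum, first over the columns and
then over the rows. Conversely, if Phi T vanishes on Ker psi, then so does it at
t(B, e_kl) - b_kl t(e_kl, e_kl), which reads (T B)_kl = b_kl (T e_kl)_kl.

The continuity of the entries of psi(u) is clear from duality for the operator space norm of S_1.
For the Schatten norm it needs |a_ij| <= Tr |A|, obtained by expanding unit vectors in an
orthonormal basis of eigenvectors of A^* A.
*)

Set Implicit Arguments.
Unset Strict Implicit.
Unset Printing Implicit Defensive.

Import Order.TTheory GRing.Theory Num.Theory.
Import numFieldNormedType.Exports.

Local Open Scope classical_set_scope.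
Local Open Scope ring_scope.

Local Notation Re := complex.Re.
Local Notation Im := complex.Im.

(** Both parts have one proof because a bounded functional on an operator space is completely
    bounded with the same norm: through [Phi], membership in CB(S_p) and in B(S_p) alike becomes
    boundedness of a functional on X, and only such functionals enter the argument. The obstacle is
    that [pairing] is an iterated unconditional sum and that [csum] has no meaning on a family that
    is not summable: the value [Phi T (t A B)] is known, but not that it is a limit of finite sums.
    The functionals of the truncations share one bound [M], which both forces summability and makes
    them equicontinuous, so that convergence on elementary tensors extends to X by density. Sign
    changes are multiplications by diagonal unitaries. Their invariance goes from the operator norm
    to S_1 by duality, to S_p by composing the admissible functions of interpolation with the sign
    change, and to [schatten_trace] by moving the eigenbasis. The isometries are then formal: the
    dual of X / Ker is the annihilator of Ker in the dual of X, and this is the image of the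
    multipliers under [Phi]. *)

Section Modulus.
Variable R : realType.
Local Notation C := R[i].
Implicit Types z w : C.

Lemma norm_rnorm (V : normedModType C) (x : V) : `|x| = (rnorm x)%:C%C.
Proof. by rewrite /rnorm RRe_real// normr_real. Qed.

Lemma norm_cmod z : `|z| = (cmod z)%:C%C.
Proof. by rewrite /cmod RRe_real// normr_real. Qed.

Lemma rnorm_ge0 (V : normedModType C) (x : V) : 0 <= rnorm x.
Proof. by rewrite -ler0c -norm_rnorm. Qed.

Lemma rnormZ (V : normedModType C) a (x : V) : rnorm (a *: x) = cmod a * rnorm x.
Proof. by apply: complexI; rewrite rmorphM /= -norm_cmod -!norm_rnorm normrZ. Qed.

Lemma cmod_ge0 z : 0 <= cmod z.
Proof. by rewrite -ler0c -norm_cmod. Qed.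

Lemma cmod0 : cmod (0 : C) = 0.
Proof. by rewrite /cmod normr0. Qed.

Lemma cmod0_eq0 z : cmod z = 0 -> z = 0.
Proof. by move=> z0; apply/normr0_eq0; rewrite norm_cmod z0. Qed.

Lemma cmod1 : cmod (1 : C) = 1.
Proof. by rewrite /cmod normr1. Qed.

Lemma cmodD z w : cmod (z + w) <= cmod z + cmod w.
Proof. by rewrite -lecR rmorphD /= -!norm_cmod ler_normD. Qed.

Lemma cmodM z w : cmod (z * w) = cmod z * cmod w.
Proof. by apply: complexI; rewrite rmorphM /= -!norm_cmod normrM. Qed.

Lemma cmodN z : cmod (- z) = cmod z.
Proof. by rewrite /cmod normrN. Qed.

Lemma cmodJ z : cmod z^* = cmod z.
Proof. by rewrite /cmod norm_conjC. Qed.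

Lemma cmodB z w : cmod (z - w) = cmod (w - z).
Proof. by rewrite /cmod distrC. Qed.

Lemma cmod_real (x : R) : cmod x%:C%C = `|x|.
Proof. by rewrite /cmod normc_def /= expr0n /= addr0 sqrtr_sqr. Qed.

Lemma cmod_sign (b : bool) : cmod ((-1) ^+ b : C) = 1.
Proof. by case: b; rewrite ?expr1 ?expr0 ?cmodN cmod1. Qed.

Lemma sqr_cmod z : ((cmod z) ^+ 2)%:C%C = z * z^*.
Proof. by rewrite rmorphXn /= -norm_cmod normCK. Qed.

Lemma cmod_sqr z : cmod z ^+ 2 = Re z ^+ 2 + Im z ^+ 2.
Proof. by apply: complexI; rewrite rmorphXn /= -norm_cmod add_Re2_Im2. Qed.

Lemma cmod_sum (J : Type) (r : seq J) (P : pred J) (x : J -> C) :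
  cmod (\sum_(j <- r | P j) x j) <= \sum_(j <- r | P j) cmod (x j).
Proof.
elim/big_ind2 : _ => [|a b c d ac bd|//]; first by rewrite cmod0.
exact: le_trans (cmodD _ _) (lerD ac bd).
Qed.

Lemma Re_le_cmod z : `|Re z| <= cmod z.
Proof. by rewrite -lecR -norm_cmod normc_ge_Re. Qed.

Lemma Im_le_cmod z : `|Im z| <= cmod z.
Proof.
by rewrite -(@ler_pXn2r _ 2) ?nnegrE ?cmod_ge0// cmod_sqr real_normK ?num_real// lerDr sqr_ge0.
Qed.

Lemma cmod_le_ReIm z : cmod z <= `|Re z| + `|Im z|.
Proof.
rewrite -(@ler_pXn2r _ 2) ?nnegrE ?cmod_ge0 ?addr_ge0// cmod_sqr sqrrD !real_normK ?num_real//.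
by have := mulr_ge0 (normr_ge0 (Re z)) (normr_ge0 (Im z)); lra.
Qed.

Lemma ReD z w : Re (z + w) = Re z + Re w.
Proof. by case: z; case: w. Qed.
Lemma ImD z w : Im (z + w) = Im z + Im w.
Proof. by case: z; case: w. Qed.

Lemma Re_sum (J : Type) (r : seq J) (P : pred J) (x : J -> C) :
  Re (\sum_(j <- r | P j) x j) = \sum_(j <- r | P j) Re (x j).
Proof. by elim/big_rec2 : _ => // j a b _ <-; rewrite ReD. Qed.
Lemma Im_sum (J : Type) (r : seq J) (P : pred J) (x : J -> C) :
  Im (\sum_(j <- r | P j) x j) = \sum_(j <- r | P j) Im (x j).
Proof. by elim/big_rec2 : _ => // j a b _ <-; rewrite ImD. Qed.

Lemma eq0_cmod_lt z : (forall e : R, 0 < e -> cmod z < e) -> z = 0.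
Proof.
move=> ze; apply: cmod0_eq0; apply/eqP; rewrite eq_le cmod_ge0 andbT leNgt.
by apply/negP => /ze; rewrite ltxx.
Qed.

End Modulus.

Lemma sum_fset_split (J : choiceType) (V : nmodType) (F G : {fset J}) (x : J -> V) :
  (F `<=` G)%fset ->
  \sum_(j <- G) x j = \sum_(j <- F) x j + \sum_(j <- (G `\` F)%fset) x j.
Proof.
move=> FG; rewrite (big_fsetID _ (mem F)) /=; congr (_ + _); apply: eq_fbigl => j.
- by rewrite !inE /= andbC; case: (boolP (j \in F)) => // /(fsubsetP FG).
- by rewrite !inE /= andbC.
Qed.

Lemma ler_sum_fset (J : choiceType) (R : numDomainType) (F G : {fset J}) (x : J -> R) :
  (forall j, 0 <= x j) -> (F `<=` G)%fset -> \sum_(j <- F) x j <= \sum_(j <- G) x j.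
Proof. by move=> x0 FG; rewrite (sum_fset_split _ FG) lerDl sumr_ge0. Qed.

(** * Unconditional sums of complex families *)

Section Unconditional.
Variable R : realType.
Local Notation C := R[i].
Variable J : choiceType.
Implicit Types (x y : J -> C) (F G : {fset J}).

(** Convergence along finite subsets is kept separate from partial sums, since it is also applied to
    nets of functionals evaluated at a point of X. *)
Definition net_lim (a : {fset J} -> C) (l : C) := forall e : R, 0 < e ->
  exists F0, forall F, (F0 `<=` F)%fset -> cmod (a F - l) < e.

Definition has_sum x (l : C) := net_lim (fun F => \sum_(j <- F) x j) l.

Lemma net_limD a b l m : net_lim a l -> net_lim b m -> net_lim (fun F => a F + b F) (l + m).
Proof.
move=> al bm e e0; have e20 : 0 < e / 2 by rewrite divr_gt0.
have [F FP] := al _ e20; have [G GP] := bm _ e20.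
exists (F `|` G)%fset => H; rewrite fsubUset => /andP[FH GH].
rewrite opprD addrACA (le_lt_trans (cmodD _ _))//.
by rewrite [e]splitr ltrD ?FP ?GP.
Qed.

Lemma net_lim_cst l : net_lim (fun=> l) l.
Proof. by move=> e e0; exists fset0 => F _; rewrite subrr cmod0. Qed.

Lemma net_lim_sum (T : Type) (r : seq T) (a : T -> {fset J} -> C) (l : T -> C) :
  (forall k, net_lim (a k) (l k)) ->
  net_lim (fun F => \sum_(k <- r) a k F) (\sum_(k <- r) l k).
Proof.
move=> al; elim: r => [|k r IH].
  by rewrite big_nil (_ : (fun _ => _) = fun=> 0) ?funeqE; [exact: net_lim_cst|move=> F; rewrite big_nil].
rewrite big_cons (_ : (fun _ => _) = fun F => a k F + \sum_(k <- r) a k F).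
  exact: net_limD.
by apply/funext => F; rewrite big_cons.
Qed.

Lemma has_sum_cvgP x l :
  has_sum x l <-> summability.partial_sum (x : J -> C^o) @ summability.totally --> (l : C^o).
Proof.
have FF := @summability.totally_filter J.
rewrite cvgrPdistC_lt; split=> [xl e e0|xl e e0].
  have ee : e = (Re e)%:C%C by rewrite RRe_real ?gtr0_real.
  have e0' : 0 < Re e by rewrite -ltcR -ee.
  have [F0 F0P] := xl _ e0'; exists F0 => // F /= F0F.
  rewrite ee [X in X < _]norm_cmod ltcR; have := F0P _ F0F.
  by rewrite /summability.partial_sum big_seq_fsetE.
have := xl e%:C%C; rewrite ltcR => /(_ e0) [F0 _ F0P].
exists F0 => F /F0P /=; rewrite [X in X < _]norm_cmod ltcR.
by rewrite /summability.partial_sum big_seq_fsetE.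
Qed.

Lemma has_sum_csum x l : has_sum x l -> csum x = l.
Proof.
move=> /has_sum_cvgP; have FF := @summability.totally_filter J.
by apply: cvg_lim; exact: norm_hausdorff.
Qed.

Lemma has_sum_csummable x l : has_sum x l -> csummable x.
Proof. by move=> /has_sum_cvgP xl; apply/cvg_ex; exists l. Qed.

Lemma csummableP x : csummable x -> has_sum x (csum x).
Proof. by move=> xl; exact/has_sum_cvgP. Qed.

Lemma has_sumD x y l m : has_sum x l -> has_sum y m -> has_sum (fun j => x j + y j) (l + m).
Proof.
move=> xl ym; rewrite /has_sum (_ : (fun F => _) =
  fun F : {fset J} => \sum_(j <- F) x j + \sum_(j <- F) y j).
  exact: net_limD.
by apply/funext => F; rewrite big_split.
Qed.

Lemma has_sum_sum (T : Type) (r : seq T) (x : T -> J -> C) (l : T -> C) :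
  (forall k, has_sum (x k) (l k)) ->
  has_sum (fun j => \sum_(k <- r) x k j) (\sum_(k <- r) l k).
Proof.
move=> xl; rewrite /has_sum (_ : (fun F => _) =
  fun F : {fset J} => \sum_(k <- r) \sum_(j <- F) x k j).
  exact: net_lim_sum.
by apply/funext => F; rewrite exchange_big.
Qed.

Lemma has_sumZ a x l : has_sum x l -> has_sum (fun j => a * x j) (a * l).
Proof.
move=> xl e e0; have c0 : 0 < cmod a + 1 by rewrite ltr_wpDl ?cmod_ge0.
have [F FP] := xl _ (divr_gt0 e0 c0); exists F => G /FP.
rewrite -mulr_sumr -mulrBr cmodM ltr_pdivlMr// => /(le_lt_trans _); apply.
by rewrite mulrC ler_wpM2l ?cmod_ge0// lerDl.
Qed.

Lemma has_sum_fin x F : (forall j, j \notin F -> x j = 0) -> has_sum x (\sum_(j <- F) x j).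
Proof.
move=> x0 e e0; exists F => G FG.
by rewrite -(big_fset_incl _ FG) ?subrr ?cmod0// => j _ /x0.
Qed.

Lemma has_sum0 : has_sum (fun=> 0) 0.
Proof. by move=> e e0; exists fset0 => F _; rewrite big1 ?subrr ?cmod0. Qed.

Lemma has_sum_unique x l m : has_sum x l -> has_sum x m -> l = m.
Proof. by move=> /has_sum_csum <- /has_sum_csum <-. Qed.

Lemma has_sum_bound x l (M : R) :
  has_sum x l -> (forall F, cmod (\sum_(j <- F) x j) <= M) -> cmod l <= M.
Proof.
move=> xl xM; apply/ler_addgt0Pr => e e0; have [F /(_ F (fsubset_refl _))] := xl _ e0.
rewrite cmodB => lF; rewrite -(subrK (\sum_(j <- F) x j) l) addrC.
by rewrite (le_trans (cmodD _ _))// lerD// ltW.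
Qed.

Lemma has_sum_ge0 (x : J -> R) (M : R) : (forall j, 0 <= x j) ->
  (forall F, \sum_(j <- F) x j <= M) -> exists l : R, has_sum (fun j => (x j)%:C%C) l%:C%C.
Proof.
move=> x0 xM; pose S := [set \sum_(j <- F) x j | F in [set: {fset J}]].
have Ssup : has_sup S.
  by split; [exists (\sum_(j <- fset0) x j), fset0|exists M => _ [F _ <-]].
exists (sup S) => e e0.
have [_ [F _ <-] FS] := sup_adherent e0 Ssup; exists F => G FG.
rewrite -rmorph_sum -rmorphB cmod_real distrC ger0_norm; last first.
  by rewrite subr_ge0; apply: ub_le_sup; [case: Ssup|exists G].
have := ler_sum_fset x0 FG.
by move: FS; lra.
Qed.

Lemma abs_has_sum x (M : R) : (forall F, \sum_(j <- F) cmod (x j) <= M) ->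
  exists l, has_sum x l.
Proof.
move=> xM.
have real_sum (r : J -> R) : (forall j, `|r j| <= cmod (x j)) ->
    exists l : R, has_sum (fun j => (r j)%:C%C) l%:C%C.
  move=> rx.
  (* A real family dominated by [cmod (x j)] is the difference of two nonnegative ones:
     [r j + cmod (x j)], with finite sums at most 2M, and [cmod (x j)]. *)
  have /(has_sum_ge0 (M := M + M))[|l lP] : forall j, 0 <= r j + cmod (x j).
  - by move=> j; have := rx j; rewrite ler_norml; lra.
  - move=> F; apply: le_trans (lerD (xM F) (xM F)); rewrite -big_split /=.
    by apply: ler_sum => j _; have := rx j; rewrite ler_norml; lra.
  have /(has_sum_ge0 (M := M))[|m mP] : forall j, 0 <= cmod (x j) by move=> j; exact: cmod_ge0.
    exact: xM.
  exists (l - m); have := has_sumD lP (has_sumZ (-1) mP).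
  rewrite mulN1r -rmorphB; congr has_sum; apply/funext => j.
  by rewrite mulN1r -rmorphB addrK.
have [a aP] := real_sum _ (fun j => Re_le_cmod (x j)).
have [b bP] := real_sum _ (fun j => Im_le_cmod (x j)).
exists (a%:C%C + 'i%C * b%:C%C); have := has_sumD aP (has_sumZ 'i%C bP).
by congr has_sum; apply/funext => j; rewrite -complexE.
Qed.

(* Four sums of real and imaginary parts of constant sign. *)
Lemma sum_cmod_bound x (M : R) : (forall F, cmod (\sum_(j <- F) x j) <= M) ->
  forall F, \sum_(j <- F) cmod (x j) <= 4 * M.
Proof.
move=> xM F.
have part (r : J -> R) : (forall G, `|\sum_(j <- G) r j| <= M) ->
    \sum_(j <- F) `|r j| <= 2 * M.
  move=> rM; rewrite (bigID (fun j => 0 <= r j)) /=.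
  have -> : \sum_(j <- F | 0 <= r j) `|r j| = \sum_(j <- [fset j in F | 0 <= r j]%fset) r j.
    by rewrite big_fset; apply: eq_bigr => j /ger0_norm.
  have -> : \sum_(j <- F | ~~ (0 <= r j)) `|r j| = - \sum_(j <- [fset j in F | ~~ (0 <= r j)]%fset) r j.
    rewrite big_fset -sumrN; apply: eq_bigr => j.
    by rewrite -ltNge => /ltr0_norm.
  have := rM [fset j in F | 0 <= r j]%fset.
  have := rM [fset j in F | ~~ (0 <= r j)]%fset.
  by rewrite !ler_norml; lra.
apply: (@le_trans _ _ (\sum_(j <- F) (`|Re (x j)| + `|Im (x j)|))).
  by apply: ler_sum => j _; exact: cmod_le_ReIm.
rewrite big_split /= (_ : 4 * M = 2 * M + 2 * M); last by lra.
by apply: lerD; apply: part => G; rewrite -?Re_sum -?Im_sum;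
  apply: le_trans (xM G); rewrite ?Re_le_cmod ?Im_le_cmod.
Qed.

(** Scalar sums cannot stay bounded over all finite sets without converging absolutely; this turns a
    norm bound on truncations into convergence of the pairing. *)
Lemma bounded_has_sum x (M : R) : (forall F, cmod (\sum_(j <- F) x j) <= M) ->
  has_sum x (csum x).
Proof.
by move=> /sum_cmod_bound /abs_has_sum[l xl]; rewrite (has_sum_csum xl).
Qed.

End Unconditional.


(** * Sign changes, matrix units and the trace pairing *)

Section Flip.
Variables (R : realType) (J K : Type).
Local Notation C := R[i].
Implicit Types A B : J -> K -> C.

(** The product D B D' with the diagonal matrices of signs (-1)^s and (-1)^s'; [(+)] merges the two
    signs into one power of -1. *)
Definition flip (s : J -> bool) (s' : K -> bool) B : J -> K -> C :=
  fun i j => (-1) ^+ (s i (+) s' j) * B i j.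

Lemma flipK s s' : involutive (flip s s').
Proof.
move=> B; apply/funext => i; apply/funext => j.
by rewrite /flip mulrA -signr_addb addbb mul1r.
Qed.

Lemma flip_linear s s' a A B : flip s s' (a *: A + B) = a *: flip s s' A + flip s s' B.
Proof.
apply/funext => i; apply/funext => j; rewrite /flip /= !fctE.
by rewrite mulrDr; congr (_ + _); rewrite /GRing.scale /= mulrCA.
Qed.

Lemma flip_signs s s' A i j : flip s s' A i j = (-1) ^+ s i * ((-1) ^+ s' j * A i j).
Proof. by rewrite /flip signr_addb mulrA. Qed.

End Flip.

Section MatrixUnits.
Variables (R : realType) (I : choiceType).
Local Notation C := R[i].
Local Notation mat := (I -> I -> C).
Implicit Types A B D : mat.

Definition delta (k l : I) : mat := fun i j => ((i == k) && (j == l))%:R.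

(** [pairing] nests [csum] in [csum], so convergence has to be supplied at both levels before its
    value can be read off. *)
Lemma pairing_iterated A B l m :
  (forall i, has_sum (fun j => A i j * B i j) (l i)) -> has_sum l m -> pairing A B = m.
Proof.
move=> ABl lm; apply: has_sum_csum; congr has_sum : lm.
by apply/funext => i; rewrite -(has_sum_csum (ABl i)).
Qed.

Lemma pairing_row_fin A B l (F : {fset I}) :
  (forall i, has_sum (fun j => A i j * B i j) (l i)) ->
  (forall i, i \notin F -> forall j, A i j * B i j = 0) ->
  pairing A B = \sum_(i <- F) l i.
Proof.
move=> ABl AB0; apply: (pairing_iterated ABl); apply: has_sum_fin => i /AB0 AB.
apply: (has_sum_unique (ABl i)).
rewrite (_ : (fun j => _) = fun=> 0) ?funeqE//; exact: has_sum0.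
Qed.

Lemma pairing_fin A B (F G : {fset I}) :
  (forall i j, ~~ ((i \in F) && (j \in G)) -> A i j * B i j = 0) ->
  pairing A B = \sum_(i <- F) \sum_(j <- G) A i j * B i j.
Proof.
move=> AB0; apply: pairing_row_fin => [i|i iF j]; last by rewrite AB0// (negbTE iF).
by apply: has_sum_fin => j jG; rewrite AB0// (negbTE jG) andbF.
Qed.

Lemma pairing_delta A k l : pairing A (delta k l) = A k l.
Proof.
rewrite (@pairing_fin _ _ [fset k]%fset [fset l]%fset) => [|i j].
  by rewrite !big_seq_fset1 /delta !eqxx mulr1.
by rewrite !inE /delta => /negbTE ->; rewrite mulr0.
Qed.

End MatrixUnits.
Arguments delta {R I}.

(** * Bounded functionals on the tensor product and the annihilator of the kernel *)

Section BoundedFunctionals.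
Variables (R : realType) (X : normedModType R[i]).
Local Notation C := R[i].
Implicit Types (f g : X -> C) (M : R).

(** The bound is a parameter and not an existential, because one [M] has to serve a whole net of
    truncations. *)
Definition bounded_functional f M :=
  [/\ 0 <= M, forall a u v, f (a *: u + v) = a * f u + f v
    & forall u, cmod (f u) <= M * rnorm u].

Lemma bounded_functionalB f M u v : bounded_functional f M -> f (u - v) = f u - f v.
Proof. by case=> _ fl _; rewrite addrC -scaleN1r fl mulN1r addrC. Qed.

Lemma bounded_functional0 f M : bounded_functional f M -> f 0 = 0.
Proof. by move=> /(@bounded_functionalB _ _ 0 0); rewrite !subrr. Qed.

Lemma bounded_functionalZ f M a u : bounded_functional f M -> f (a *: u) = a * f u.
Proof. by move=> fM; case: (fM) => _ fl _; rewrite -[a *: u]addr0 fl (bounded_functional0 fM) addr0. Qed.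

Lemma bounded_functional_sum f M (T : Type) (r : seq T) (u : T -> X) :
  bounded_functional f M -> f (\sum_(k <- r) u k) = \sum_(k <- r) f (u k).
Proof.
move=> fM; elim/big_rec2 : _ => [|k a b _ <-]; first exact: bounded_functional0 fM.
by case: fM => _ fl _; rewrite -[u k]scale1r fl scale1r mul1r.
Qed.

Lemma bounded_functional_lin f g M N a b :
  bounded_functional f M -> bounded_functional g N ->
  bounded_functional (fun u => a * f u + b * g u) (cmod a * M + cmod b * N).
Proof.
move=> [M0 fl fM] [N0 gl gN]; split.
- by rewrite addr_ge0// mulr_ge0// cmod_ge0.
- by move=> c u v; rewrite fl gl; ring.
- move=> u; rewrite (le_trans (cmodD _ _))// !cmodM mulrDl.
  by rewrite lerD// -mulrA ler_wpM2l ?cmod_ge0.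
Qed.

Lemma bounded_functional_bigsum (T : Type) (r : seq T) (a : T -> C) (f : T -> X -> C) :
  (forall k, exists M, bounded_functional (f k) M) ->
  exists M, bounded_functional (fun u => \sum_(k <- r) a k * f k u) M.
Proof.
move=> fM; elim: r => [|k r [N IH]].
  exists 0; split=> // [c u v|u]; rewrite !big_nil ?mulr0 ?addr0//.
  by rewrite cmod0 mul0r.
have [M fkM] := fM k; have := bounded_functional_lin (a k) 1 fkM IH.
move=> H; eexists; congr bounded_functional : H.
by apply/funext => u; rewrite big_cons mul1r.
Qed.

End BoundedFunctionals.

(* Sp, Sq and dom stand for the Schatten classes S_p and S_p^* and for B(S_p) or CB(S_p). *)
Section SchurFunctionals.
Variables (R : realType) (I : choiceType).
Local Notation C := R[i].
Local Notation mat := (I -> I -> C).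
Variables (X : normedModType C) (t : mat -> mat -> X) (Sp Sq : set mat).
Variables (dom : set (mat -> mat)) (Phi : (mat -> mat) -> X -> C) (psi : {linear X -> mat}).

Hypothesis Phi_bounded : forall T, dom T -> exists M, bounded_functional (Phi T) M.
(** The bound [M] is unchanged: this is the source of the common bound of the truncations. *)
Hypothesis Phi_flip : forall T M s s', dom T -> bounded_functional (Phi T) M ->
  dom (T \o flip s s') /\ bounded_functional (Phi (T \o flip s s')) M.
Hypothesis Phi_onto : forall f M, bounded_functional f M -> exists2 T, dom T & Phi T = f.
Hypothesis Phi_tensor : forall T A B, dom T -> Sp A -> Sq B -> Phi T (t A B) = pairing (T A) B.
Hypothesis psi_tensor : forall A B, Sp A -> Sq B -> psi (t A B) = schur A B.
Hypothesis psi_entry : forall i j, exists2 M, 0 <= M & forall u, cmod (psi u i j) <= M * rnorm u.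
Hypothesis tensor_dense : forall u (e : R), 0 < e ->
  exists (n : nat) (x : 'I_n -> mat) (y : 'I_n -> mat),
    [/\ forall k, Sp (x k), forall k, Sq (y k) & rnorm (u - \sum_k t (x k) (y k)) < e].
Hypothesis Sp_delta : forall k l, Sp (delta k l).
Hypothesis Sq_delta : forall k l, Sq (delta k l).
Hypothesis Sp_flip : forall s s' B, Sp B -> Sp (flip s s' B).

(** Three-epsilon argument: functionals with a common bound that converge on elementary tensors
    converge at every point, as sums of tensors are dense. *)
Lemma net_lim_functional (f : X -> C) (fn : {fset I} -> X -> C) M u :
  bounded_functional f M -> (forall F, bounded_functional (fn F) M) ->
  (forall A B, Sp A -> Sq B -> net_lim (fun F => fn F (t A B)) (f (t A B))) ->
  net_lim (fun F => fn F u) (f u).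
Proof.
move=> fM fnM fnf e e0; have M0 : 0 <= M by case: fM.
(* The +1 keeps the divisor positive when [M] is 0; each of the three differences will be below
   e/3. *)
have d0 : 0 < e / (3 * (M + 1)) by rewrite divr_gt0// mulr_gt0// ltr_wpDl.
have [n [x [y [xS yS uxy]]]] := tensor_dense u d0.
set v := \sum_k _ in uxy.
have e30 : 0 < e / 3 by rewrite divr_gt0.
have [F0 F0P] : exists F0 : {fset I}, forall F, (F0 `<=` F)%fset -> cmod (fn F v - f v) < e / 3.
  have := @net_lim_sum R I 'I_n (index_enum 'I_n) (fun k F => fn F (t (x k) (y k)))
    (fun k => f (t (x k) (y k))) (fun k => fnf _ _ (xS k) (yS k)).
  move=> /(_ _ e30) [F0 F0P]; exists F0 => F /F0P.
  by rewrite /v (bounded_functional_sum _ _ fM) (bounded_functional_sum _ _ (fnM F)).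
have small (g : X -> C) : bounded_functional g M -> cmod (g u - g v) < e / 3.
  move=> gM; rewrite -(bounded_functionalB _ _ gM).
  case: gM => _ _ /(_ (u - v)) /le_lt_trans; apply.
  apply: (@le_lt_trans _ _ ((M + 1) * rnorm (u - v))).
    by rewrite ler_wpM2r ?rnorm_ge0// lerDl.
  move: uxy; rewrite invfM mulrA ltr_pdivlMr ?ltr_wpDl//.
  by rewrite mulrC.
exists F0 => F /F0P FP.
have := small _ fM; have := small _ (fnM F); rewrite cmodB => H1 H2.
have -> : fn F u - f u = (fn F u - fn F v) + ((fn F v - f v) + (f v - f u)) by ring.
apply: (le_lt_trans (cmodD _ _)); rewrite (_ : e = e / 3 + (e / 3 + e / 3)); last by lra.
rewrite cmodB ltrD//; apply: (le_lt_trans (cmodD _ _)); rewrite ltrD//.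
by rewrite cmodB.
Qed.

(** On tensors the difference of the two functionals is the limit of a net of zeros, hence it is so
    everywhere by the preceding lemma. *)
Lemma bounded_functional_ext f g M N u : bounded_functional f M -> bounded_functional g N ->
  (forall A B, Sp A -> Sq B -> f (t A B) = g (t A B)) -> f u = g u.
Proof.
move=> fM gN fg; have := bounded_functional_lin 1 (-1) fM gN.
set h := fun u => _; have h0 : bounded_functional (fun _ : X => 0 : C) (M + N).
  case: fM gN => M0 _ _ [N0 _ _]; split => [|*|v]; rewrite ?addr_ge0 ?mulr0 ?addr0//.
  by rewrite cmod0 mulr_ge0 ?rnorm_ge0 ?addr_ge0.
rewrite cmodN cmod1 !mul1r => hM.
have : net_lim (fun F : {fset I} => 0) (h u).
  apply: (@net_lim_functional h (fun=> fun=> 0) _ u hM (fun=> h0)) => A B SA SB.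
  by rewrite /h fg// mul1r mulN1r subrr; exact: net_lim_cst.
move=> hu; suff : h u = 0 by rewrite /h mul1r mulN1r => /eqP; rewrite subr_eq0 => /eqP.
apply: eq0_cmod_lt => e /hu[F /(_ _ (fsubset_refl _))].
by rewrite sub0r cmodN.
Qed.

(** The bound is put on the functional [Phi T], since [dom] carries no norm here; [T] matters on
    [Sp] only. *)
Definition multiplier_bound A M :=
  exists T, [/\ dom T, bounded_functional (Phi T) M & forall B, Sp B -> T B = schur A B].

Lemma multiplier_bound_flip A M s s' : multiplier_bound A M ->
  multiplier_bound (fun i j => (1 + (-1) ^+ (s i (+) s' j)) / 2 * A i j) M.
Proof.
move=> [T [domT TM TA]]; have [domT' TM'] := Phi_flip s s' domT TM.
have := bounded_functional_lin 2^-1 2^-1 TM TM'.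
rewrite -mulrDl; set f := fun u => _.
have -> : cmod (2^-1 : C) = 2^-1.
  by rewrite (_ : 2^-1 = (2^-1)%:C%C) ?cmod_real ?ger0_norm ?invr_ge0// fmorphV rmorph_nat.
rewrite (_ : 2^-1 + 2^-1 = 1 :> R) ?mul1r => [fM|]; last by field.
have [S domS SE] := Phi_onto fM; exists S; split=> // [|B SpB].
  by rewrite SE.
(* [S] is known only through its functional, so its entries are recovered by pairing [S B] with
   matrix units. *)
apply/funext => k; apply/funext => l.
rewrite -pairing_delta -Phi_tensor// SE /f !Phi_tensor// !pairing_delta /=.
by rewrite !TA//; [rewrite /schur /flip; field|exact: Sp_flip].
Qed.

Definition cut (s s' : I -> bool) (A : mat) : mat := fun i j => (s i && s' j)%:R * A i j.

Lemma multiplier_bound_cut A M s s' : multiplier_bound A M -> multiplier_bound (cut s s' A) M.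
Proof.
(* With the sign -1 exactly off [s], half of 1 plus the sign is the indicator of [s]; rows and
   columns are treated in turn. *)
move=> /(multiplier_bound_flip (fun i => ~~ s i) (fun=> false)).
move=> /(multiplier_bound_flip (fun=> false) (fun j => ~~ s' j)).
congr multiplier_bound; apply/funext => i; apply/funext => j; rewrite /cut.
by case: (s i); case: (s' j) => /=; rewrite ?expr0 ?expr1; field.
Qed.

Lemma Phi_cut_fin A T (F G : {fset I}) u : dom T ->
  (forall B, Sp B -> T B = schur (cut (mem F) (mem G) A) B) ->
  Phi T u = \sum_(i <- F) \sum_(j <- G) A i j * psi u i j.
Proof.
move=> domT TA; have [M TM] := Phi_bounded domT.
have entry i j : exists M, bounded_functional (fun u => psi u i j) M.
  have [N N0 psiN] := psi_entry i j; exists N; split=> // a v w.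
  by rewrite linearP.
have row i := bounded_functional_bigsum G (A i) (fun j => entry i j).
have [N] := bounded_functional_bigsum F (fun=> 1) (fun i => row i).
set g := fun u => _ => gN.
have -> : \sum_(i <- F) \sum_(j <- G) A i j * psi u i j = g u.
  by apply: eq_bigr => i _; rewrite mul1r.
apply: (bounded_functional_ext u TM gN) => B D SB SD.
rewrite Phi_tensor// TA// (@pairing_fin _ _ _ _ F G) => [|i j FG]; last first.
  by rewrite /schur /cut /= (negbTE FG) !mul0r.
rewrite /g; apply: eq_big_seq => i iF; rewrite mul1r; apply: eq_big_seq => j jG.
by rewrite psi_tensor// /schur /cut /= iF jG mul1r mulrA.
Qed.

(** The finite truncations vanish at [u]; the set of columns then grows before the set of rows,
    because [pairing] sums in this order. *)
Lemma Phi_multiplier_kernel A T u : dom T ->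
  (forall B, Sp B -> T B = schur A B) -> psi u = 0 -> Phi T u = 0.
Proof.
move=> domT TA psiu; have [M TM] := Phi_bounded domT.
(* Choice turns the truncated multipliers into a family, all with the bound [M] of [Phi T]. *)
have Acut s s' : {S | [/\ dom S, bounded_functional (Phi S) M &
    forall B, Sp B -> S B = schur (cut s s' A) B]}.
  by apply/cid/multiplier_bound_cut; exists T.
pose Tc s s' := sval (Acut s s').
have domc s s' : dom (Tc s s') by rewrite /Tc; case: (Acut s s') => S [].
have bndc s s' : bounded_functional (Phi (Tc s s')) M by rewrite /Tc; case: (Acut s s') => S [].
have cutE s s' B : Sp B -> Tc s s' B = schur (cut s s' A) B.
  by rewrite /Tc; case: (Acut s s') => S [] /= _ _; apply.
have PhiFG F G B D : Sp B -> Sq D -> Phi (Tc (mem F) (mem G)) (t B D) =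
    \sum_(i <- (F : {fset I})) \sum_(j <- (G : {fset I})) schur A B i j * D i j.
  move=> SB SD; rewrite (Phi_cut_fin _ (domc _ _) (cutE _ _)).
  apply: eq_bigr => i _; apply: eq_bigr => j _.
  by rewrite psi_tensor// /schur mulrA.
have has_row B D i : Sp B -> Sq D -> has_sum (fun j => schur A B i j * D i j)
    (csum (fun j => schur A B i j * D i j)).
  move=> SB SD; apply: (@bounded_has_sum _ _ _ (M * rnorm (t B D))) => G.
  (* Cutting to the single row [i] isolates its sums over [G], which are thus bounded independently
     of [G]. *)
  have [_ _ /(_ (t B D))] := bndc (mem [fset i]%fset) (mem G).
  by rewrite PhiFG// big_seq_fset1.
have PhiF F B D : Sp B -> Sq D -> Phi (Tc (mem F) predT) (t B D) =
    \sum_(i <- (F : {fset I})) csum (fun j => schur A B i j * D i j).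
  move=> SB SD; rewrite Phi_tensor// cutE//.
  (* Rows outside [F] get weight 0, so the outer sum is finite and only the row sums have to
     converge. *)
  rewrite (@pairing_row_fin _ _ _ _ (fun i => (i \in F)%:R * csum (fun j => schur A B i j * D i j)) F).
  - by apply: eq_big_seq => i ->; rewrite mul1r.
  - move=> i; have := has_sumZ (i \in F)%:R (has_row B D i SB SD).
    congr has_sum; apply/funext => j.
    by rewrite /schur /cut /= andbT !mulrA.
  - by move=> i iF j; rewrite /schur /cut /= (negbTE iF) !mul0r.
(* For fixed [F] the growing sets [G] give a net of zeros at [u], by the finite formula and
   [psi u = 0]. *)
have PhiF0 (F : {fset I}) : Phi (Tc (mem F) predT) u = 0.
  apply: eq0_cmod_lt => e e0.
  have : net_lim (fun G : {fset I} => Phi (Tc (mem F) (mem G)) u) (Phi (Tc (mem F) predT) u).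
    apply: (@net_lim_functional _ (fun G => Phi (Tc (mem F) (mem G))) _ u (bndc _ _) (fun G => bndc _ _)) => B D SB SD.
    rewrite PhiF//; have := has_sum_sum F (fun i => has_row B D i SB SD).
    congr net_lim; apply/funext => G; rewrite PhiFG//.
    by rewrite exchange_big.
  move=> /(_ _ e0)[G /(_ _ (fsubset_refl _))].
  rewrite (Phi_cut_fin _ (domc _ _) (cutE _ _)) psiu.
  rewrite big1 ?sub0r ?cmodN// => i _; rewrite big1// => j _.
  by rewrite mulr0.
apply: eq0_cmod_lt => e e0.
have : net_lim (fun F : {fset I} => Phi (Tc (mem F) predT) u) (Phi T u).
  apply: (@net_lim_functional _ (fun F => Phi (Tc (mem F) predT)) _ u TM (fun F => bndc _ _)) => B D SB SD.
  rewrite Phi_tensor// TA//.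
  (* The functional of the cut to the rows in [F] is the partial sum over [F] of the row sums, so
     the common bound makes these summable too. *)
  have rows : has_sum (fun i => csum (fun j => schur A B i j * D i j))
      (csum (fun i => csum (fun j => schur A B i j * D i j))).
    apply: (@bounded_has_sum _ _ _ (M * rnorm (t B D))) => F.
    have [_ _ /(_ (t B D))] := bndc (mem F) predT.
    by rewrite PhiF.
  have -> := pairing_iterated (fun i => has_row B D i SB SD) rows.
  move: rows; congr net_lim; apply/funext => F.
  by rewrite PhiF.
move=> /(_ _ e0)[F /(_ _ (fsubset_refl _))].
by rewrite PhiF0 sub0r cmodN.
Qed.

Lemma kernel_multiplier T : dom T -> (forall u, psi u = 0 -> Phi T u = 0) ->
  forall B, Sp B -> T B = schur (fun k l => T (delta k l) k l) B.
Proof.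
move=> domT T0 B SB; apply/funext => k; apply/funext => l.
have [M TM] := Phi_bounded domT.
have := T0 (t B (delta k l) - B k l *: t (delta k l) (delta k l)).
rewrite linearB linearZ /= !psi_tensor// => H.
rewrite /schur mulrC -[LHS]pairing_delta -[in RHS](pairing_delta (T _)).
rewrite -!Phi_tensor//; apply/eqP; rewrite -subr_eq0 -(bounded_functionalZ _ _ TM).
rewrite -(bounded_functionalB _ _ TM) H//.
apply/funext => i; apply/funext => j; rewrite /schur /delta !fctE /GRing.scale /=.
by case: (eqVneq i k) => [->|]; case: (eqVneq j l) => [->|] /=; rewrite ?mulr0 ?subr0 ?mulr1 ?subrr.
Qed.

(** The entry functional at (i, j) of [psi] is bounded and vanishes on the kernel, so it is [Phi T]
    for a multiplier [T]; an element killed by all multipliers therefore has zero entries. *)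
Lemma kernel_entry u : (forall T A, dom T -> (forall B, Sp B -> T B = schur A B) ->
  Phi T u = 0) -> psi u = 0.
Proof.
move=> u0; apply/funext => i; apply/funext => j.
have [M M0 psiM] := psi_entry i j.
have psib : bounded_functional (fun u => psi u i j) M.
  by split=> // a v w; rewrite linearP.
have [T domT TE] := Phi_onto psib.
suff /(u0 T _ domT) : forall B, Sp B -> T B = schur (fun k l => T (delta k l) k l) B.
  by rewrite TE.
by apply: kernel_multiplier => // v; rewrite TE => ->.
Qed.

Theorem schur_annihilator :
  [/\ forall T A u, dom T -> (forall B, Sp B -> T B = schur A B) -> psi u = 0 -> Phi T u = 0,
      forall T, dom T -> (forall u, psi u = 0 -> Phi T u = 0) ->
        exists A, forall B, Sp B -> T B = schur A B
    & forall u, (forall T A, dom T -> (forall B, Sp B -> T B = schur A B) -> Phi T u = 0) ->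
        psi u = 0].
Proof.
split=> [T A u domT TA u0|T domT T0|]; [exact: Phi_multiplier_kernel TA u0| |exact: kernel_entry].
by eexists => B; exact: kernel_multiplier.
Qed.

End SchurFunctionals.


(** * Square-summable families and matrices acting on them *)

Lemma cauchy_schwarz_seq (R : realType) (J : Type) (r : seq J) (x y : J -> R) :
  (forall j, 0 <= x j) -> (forall j, 0 <= y j) ->
  \sum_(j <- r) x j * y j <=
    Num.sqrt (\sum_(j <- r) x j ^+ 2) * Num.sqrt (\sum_(j <- r) y j ^+ 2).
Proof.
move=> x0 y0; elim: r => [|j r IH]; first by rewrite !big_nil sqrtr0 mulr0.
rewrite !big_cons; set S := \sum_(_ <- _) _ * _ in IH *.
set A := \sum_(_ <- _) _ in IH *; set B := \sum_(_ <- _) _ in IH *.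
have A0 : 0 <= A by apply: sumr_ge0 => k _; exact: sqr_ge0.
have B0 : 0 <= B by apply: sumr_ge0 => k _; exact: sqr_ge0.
have sA := sqr_sqrtr A0; have sB := sqr_sqrtr B0.
apply: (@le_trans _ _ (x j * y j + Num.sqrt A * Num.sqrt B)); first by rewrite lerD2l.
rewrite -[X in _ <= X]sqrtrM ?addr_ge0 ?sqr_ge0// -(@ler_pXn2r _ 2) ?nnegrE ?sqrtr_ge0//; last first.
  by rewrite addr_ge0 ?mulr_ge0 ?sqrtr_ge0.
rewrite [X in _ <= X]sqr_sqrtr ?mulr_ge0 ?addr_ge0 ?sqr_ge0// -[in X in _ <= X]sA -[in X in _ <= X]sB.
(* What remains after squaring is Cauchy-Schwarz in the plane, for (x_j, sqrt A) and (y_j, sqrt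
   B). *)
have := sqr_ge0 (x j * Num.sqrt B - y j * Num.sqrt A); rewrite sqrrB; lra.
Qed.

Section SquareSummable.
Variable R : realType.
Local Notation C := R[i].

Lemma esum_leP (J : choiceType) (a : J -> R) (M : R) :
  (\esum_(j in [set: J]) (a j)%:E <= M%:E)%E <->
  forall F : {fset J}, \sum_(j <- F) a j <= M.
Proof.
split=> [aM F|aM].
  rewrite -lee_fin; apply: le_trans aM; apply: esum_ge; exists [set` F] => //.
  by rewrite fsbig_finite//= set_fsetK sumEFin.
apply: ge_ereal_sup => _ [A [finA _] <-].
by rewrite fsbig_finite//= sumEFin lee_fin.
Qed.

Section OneIndex.
Variable J : choiceType.
Implicit Types x y : J -> C.

(** Finite real sums stand in for the extended real [l2norm]; [l2norm_leP] translates. *)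
Definition l2_bound x (M : R) := forall F : {fset J}, \sum_(j <- F) cmod (x j) ^+ 2 <= M ^+ 2.

Lemma l2norm_leP x M : 0 <= M -> (l2norm x <= M%:E)%E <-> l2_bound x M.
Proof.
move=> M0; apply: (iff_trans _ (esum_leP _ _)); rewrite /l2norm.
have e0 : (0 <= \esum_(j in [set: J]) (cmod (x j) ^+ 2)%:E)%E.
  by apply: esum_ge0 => j _; rewrite lee_fin sqr_ge0.
rewrite poweR12_sqrt//; case: (esum _ _) e0 => [r|//|//].
  rewrite lee_fin => r0; rewrite /= !lee_fin -[X in _ <-> _ <= X]sqr_sqrtr ?sqr_ge0//.
  split=> H; first by rewrite -(sqr_sqrtr r0) ler_pXn2r ?nnegrE ?sqrtr_ge0// sqrtr_sqr ger0_norm.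
  move: H; rewrite -{1}(sqr_sqrtr r0) ler_pXn2r ?nnegrE ?sqrtr_ge0//.
  by rewrite sqrtr_sqr ger0_norm.
Qed.

Lemma l2norm_ge0 x : (0 <= l2norm x)%E.
Proof. exact: poweR_ge0. Qed.

Lemma l2P x : l2 x <-> exists2 M, 0 <= M & l2_bound x M.
Proof.
split=> [|[M M0 /(l2norm_leP _ M0) xM]]; last by apply: le_lt_trans xM _; rewrite ltry.
rewrite /l2 /= => xy; have x0 := l2norm_ge0 x.
have xfin : l2norm x \is a fin_num by rewrite ge0_fin_numE.
exists (fine (l2norm x)); first exact: fine_ge0.
by apply/l2norm_leP; rewrite ?fine_ge0 ?fineK.
Qed.

Lemma l2_bound_sqrt x (F : {fset J}) M : 0 <= M -> l2_bound x M ->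
  Num.sqrt (\sum_(j <- F) cmod (x j) ^+ 2) <= M.
Proof.
move=> M0 /(_ F) xM; rewrite -[M]ger0_norm// -sqrtr_sqr.
exact: ler_wsqrtr.
Qed.

Lemma sum_cmodM_le x y a b (F : {fset J}) : 0 <= a -> 0 <= b -> l2_bound x a -> l2_bound y b ->
  \sum_(j <- F) cmod (x j) * cmod (y j) <= a * b.
Proof.
move=> a0 b0 xa yb; apply: le_trans (cauchy_schwarz_seq _ _ _) _ => [j|j|].
- exact: cmod_ge0.
- exact: cmod_ge0.
- by apply: ler_pM; rewrite ?sqrtr_ge0 ?l2_bound_sqrt.
Qed.

Lemma l2_boundD x y a b : 0 <= a -> 0 <= b -> l2_bound x a -> l2_bound y b ->
  l2_bound (fun j => x j + y j) (a + b).
Proof.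
move=> a0 b0 xa yb F; have xy := sum_cmodM_le F a0 b0 xa yb.
apply: (@le_trans _ _ (\sum_(j <- F) (cmod (x j) ^+ 2 + cmod (y j) ^+ 2
    + 2 * (cmod (x j) * cmod (y j))))).
  apply: ler_sum => j _; apply: (@le_trans _ _ ((cmod (x j) + cmod (y j)) ^+ 2)).
    by rewrite ler_pXn2r ?nnegrE ?cmod_ge0 ?addr_ge0 ?cmod_ge0// cmodD.
  by rewrite sqrrD; lra.
rewrite !big_split /= -mulr_sumr sqrrD; have := xa F; have := yb F; lra.
Qed.

Lemma l2_boundZ c x a : l2_bound x a -> l2_bound (fun j => c * x j) (cmod c * a).
Proof.
move=> xa F; under eq_bigr do rewrite cmodM exprMn.
by rewrite -mulr_sumr exprMn ler_wpM2l ?sqr_ge0.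
Qed.

Lemma l2_bound0 M : l2_bound (fun=> 0) M.
Proof. by move=> F; rewrite big1 ?sqr_ge0// => j _; rewrite cmod0 expr0n. Qed.

Lemma l2_boundJ x a : l2_bound x a -> l2_bound (fun j => (x j)^*) a.
Proof. by move=> xa F; under eq_bigr do rewrite cmodJ. Qed.

Lemma l2_bound_entry x a j : 0 <= a -> l2_bound x a -> cmod (x j) <= a.
Proof.
move=> a0 /(_ [fset j]%fset); rewrite big_seq_fset1.
by rewrite ler_pXn2r ?nnegrE ?cmod_ge0.
Qed.

Lemma l2_product x y a b : 0 <= a -> 0 <= b -> l2_bound x a -> l2_bound y b ->
  has_sum (fun j => x j * y j) (csum (fun j => x j * y j)) /\
  cmod (csum (fun j => x j * y j)) <= a * b.
Proof.
move=> a0 b0 xa yb; have xy (F : {fset J}) : cmod (\sum_(j <- F) x j * y j) <= a * b.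
  apply: le_trans (cmod_sum _ _ _) _; under eq_bigr do rewrite cmodM.
  exact: sum_cmodM_le.
have H := bounded_has_sum xy; split=> //.
exact: has_sum_bound H xy.
Qed.

(** The norm over [F] is attained on the conjugate of [h] cut to [F]. Testing on finitely supported
    [y] keeps the sums finite, so that square-summability itself can be proved this way. *)
Lemma l2_dual h M : 0 <= M ->
  (forall (y : J -> C) (b : R) (F : {fset J}), 0 <= b -> l2_bound y b ->
     (forall j, j \notin F -> y j = 0) -> cmod (\sum_(j <- F) h j * y j) <= M * b) ->
  l2_bound h M.
Proof.
move=> M0 hM F; set S := \sum_(j <- F) _.
have S0 : 0 <= S by apply: sumr_ge0 => j _; exact: sqr_ge0.
pose y := fun j => if j \in F then (h j)^* else 0.
have yS : l2_bound y (Num.sqrt S).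
  move=> G; rewrite sqr_sqrtr//.
  have -> : \sum_(j <- G) cmod (y j) ^+ 2 = \sum_(j <- [fset j in G | j \in F]%fset) cmod (y j) ^+ 2.
    rewrite [LHS](bigID (fun j => j \in F)) /= [X in _ + X]big1 ?addr0.
      by rewrite big_fset_condE.
    by move=> j jF; rewrite /y (negbTE jF) cmod0 expr0n.
  apply: (@le_trans _ _ (\sum_(j <- F) cmod (y j) ^+ 2)).
    apply: ler_sum_fset => [j|]; first exact: sqr_ge0.
    by apply/fsubsetP => j; rewrite !inE => /andP[].
  rewrite /S le_eqVlt; apply/orP; left; apply/eqP.
  by apply: eq_big_seq => j jF; rewrite /y jF cmodJ.
have yF j : j \notin F -> y j = 0 by rewrite /y => /negbTE ->.
have := hM y (Num.sqrt S) F (sqrtr_ge0 _) yS yF.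
have -> : \sum_(j <- F) h j * y j = S%:C%C.
  rewrite /S rmorph_sum /=; apply: eq_big_seq => j jF.
  by rewrite /y jF sqr_cmod.
rewrite cmod_real ger0_norm// => SM.
(* The test gives S <= M sqrt S, to be divided by sqrt S unless S is 0. *)
have [S_gt0|] := ltP 0 S; last by move=> /le_trans; apply; exact: sqr_ge0.
rewrite -[S]sqr_sqrtr// ler_pXn2r ?nnegrE ?sqrtr_ge0//.
have : 0 < Num.sqrt S by rewrite sqrtr_gt0.
by move=> sS; rewrite -(ler_pM2r sS) -expr2 sqr_sqrtr.
Qed.

End OneIndex.

Section Operators.
Variables J K : choiceType.
Implicit Types (A : J -> K -> C) (x : K -> C).

(** Convergence of the row sums is part of the bound, as in [opnorm]; the radius [a] is free so that
    bounds compose without rescaling. *)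
Definition op_bound A (M : R) := forall x a, 0 <= a -> l2_bound x a ->
  (forall j, has_sum (fun k => A j k * x k) (mulv A x j)) /\ l2_bound (mulv A x) (M * a).

Lemma mulvZ A c x : (forall j, has_sum (fun k => A j k * x k) (mulv A x j)) ->
  mulv A (fun k => c * x k) = fun j => c * mulv A x j.
Proof.
move=> Ax; apply/funext => j; apply: has_sum_csum; have := has_sumZ c (Ax j).
by congr has_sum; apply/funext => k; rewrite mulrCA.
Qed.

Lemma opnorm_leP A M : 0 <= M -> (opnorm A <= M%:E)%E <-> op_bound A M.
Proof.
move=> M0; rewrite /opnorm; case: asboolP => [Asum|Asum]; split=> AM //.
- move=> x a a0 xa.
  have Ax j : has_sum (fun k => A j k * x k) (mulv A x j).
    by apply: csummableP; apply: Asum; apply/l2P; exists a.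
  split=> //.
  have ball (y : K -> C) : l2_bound y 1 -> l2_bound (mulv A y) M.
    move=> y1; apply/l2norm_leP => //; apply: le_trans AM; apply: ereal_sup_ubound.
    by exists y => //=; apply/(@l2norm_leP _ _ 1).
  (* A ball of radius 0 cannot be rescaled to the unit ball, but there [x] vanishes. *)
  move: a0; rewrite le_eqVlt => /predU1P[a0|a0].
    have -> : mulv A x = fun=> 0.
      apply/funext => j; rewrite -[LHS]mul1r -(has_sum_csum (has_sumZ 1 (Ax j))).
      rewrite (_ : (fun _ => _) = fun=> 0) ?funeqE => [|k].
        exact/has_sum_csum/has_sum0.
      have := l2_bound_entry k (lexx 0); rewrite {1}a0 => /(_ _ xa) xk.
      by rewrite (cmod0_eq0 (le_anti (introT andP (conj xk (cmod_ge0 _))))) !mulr0.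
    exact: l2_bound0.
  have := l2_boundZ (a^-1)%:C%C xa; rewrite cmod_real gtr0_norm ?invr_gt0// mulVf ?gt_eqF//.
  move=> /ball; rewrite mulvZ// => /(l2_boundZ a%:C%C).
  rewrite cmod_real gtr0_norm// mulrC; congr l2_bound; apply/funext => j.
  by rewrite mulrA -rmorphM mulfV ?gt_eqF// mul1r.
- apply: ge_ereal_sup => _ [x /= x1 <-]; apply/l2norm_leP => //.
  have /(@l2norm_leP _ _ 1) {}x1 := x1; rewrite -[M]mulr1.
  by case: (AM x 1 ler01 (x1 ler01)).
- exfalso; apply: Asum => x j /l2P[a a0 xa].
  by have [/(_ j) /has_sum_csummable] := AM x a a0 xa.
Qed.

Lemma opnorm_ge0 A : (0 <= opnorm A)%E.
Proof.
rewrite /opnorm; case: asboolP => // _; apply: le_trans (l2norm_ge0 (mulv A (fun=> 0))) _.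
by apply: ereal_sup_ubound; exists (fun=> 0) => //=; apply/(@l2norm_leP _ _ 1) => //; exact: l2_bound0.
Qed.

Lemma opnorm_lty A : (opnorm A < +oo)%E -> exists2 M, 0 <= M & op_bound A M.
Proof.
move=> Ay; have A0 := opnorm_ge0 A.
have Afin : opnorm A \is a fin_num by rewrite ge0_fin_numE.
exists (fine (opnorm A)); first exact: fine_ge0.
by apply/opnorm_leP; rewrite ?fine_ge0 ?fineK.
Qed.

Lemma op_bound_row A M j : 0 <= M -> op_bound A M -> l2_bound (A j) M.
Proof.
move=> M0 AM; apply: l2_dual => // y b F b0 yb yF.
have [_ /(l2_bound_entry j (mulr_ge0 M0 b0))] := AM y b b0 yb.
rewrite /mulv (@has_sum_csum _ _ _ (\sum_(k <- F) A j k * y k))//.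
by apply: has_sum_fin => k /yF ->; rewrite mulr0.
Qed.

End Operators.

End SquareSummable.


(** * Orthonormal bases: Bessel's inequality, series and expansion of unit vectors *)

Section NonnegativeSums.
Variables (R : realType) (J : choiceType).
Implicit Types x : J -> R.

Lemma net_lim_Re (a : {fset J} -> R[i]) l (e : R) : net_lim a l -> 0 < e ->
  exists F0, forall F, (F0 `<=` F)%fset -> `|Re (a F) - Re l| < e.
Proof.
move=> al e0; have [F0 F0P] := al _ e0; exists F0 => F /F0P; apply: le_lt_trans.
by apply: le_trans (Re_le_cmod _); rewrite ReD; case: (l).
Qed.

Lemma net_lim_le (a : {fset J} -> R[i]) l (M : R) : net_lim a l ->
  (forall F, Re (a F) <= M) -> Re l <= M.
Proof.
move=> al aM; apply/ler_addgt0Pr => e e0.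
have [F /(_ F (fsubset_refl _))] := net_lim_Re al e0.
by have := aM F; rewrite ltr_norml; lra.
Qed.

Lemma net_lim_ge (a : {fset J} -> R[i]) l (M : R) F0 : net_lim a l ->
  (forall F, (F0 `<=` F)%fset -> M <= Re (a F)) -> M <= Re l.
Proof.
move=> al aM; apply/ler_addgt0Pr => e e0.
have [F /(_ _ (fsubsetUr F0 F))] := net_lim_Re al e0.
by have := aM _ (fsubsetUl F0 F); rewrite ltr_norml; lra.
Qed.

Lemma has_sum_ge0_ub x (l : R[i]) (F : {fset J}) : (forall j, 0 <= x j) ->
  has_sum (fun j => (x j)%:C%C) l -> \sum_(j <- F) x j <= Re l.
Proof.
move=> x0 xl; apply: (net_lim_ge (F0 := F) xl) => G FG.
by rewrite -rmorph_sum /=; apply: ler_sum_fset.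
Qed.

End NonnegativeSums.

Section UnitVectors.
Variables (R : realType) (J : choiceType).
Local Notation C := R[i].

Lemma unit_l2_bound (l : J) : l2_bound (fun j => (j == l)%:R : C) 1.
Proof.
move=> F; rewrite expr1n; apply: le_trans (_ : \sum_(j <- F) (j == l)%:R <= 1 :> R).
  apply: ler_sum => j _; case: (j == l); rewrite ?cmod1 ?cmod0 ?expr1n ?expr0n//.
have [lF|lF] := boolP (l \in F).
  rewrite (bigD1_seq l)//= eqxx big1 ?addr0// => j /negbTE -> //.
by rewrite big1_seq// => j /andP[_ jF]; case: eqP jF lF => // -> ->.
Qed.

Lemma has_sum_unit (x : J -> C) l : has_sum (fun j => x j * (j == l)%:R) (x l).
Proof.
have -> : x l = \sum_(j <- [fset l]%fset) x j * (j == l)%:R.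
  by rewrite big_seq_fset1 eqxx mulr1.
by apply: has_sum_fin => j; rewrite inE => /negbTE ->; rewrite mulr0.
Qed.

End UnitVectors.

Section OrthonormalBasis.
Variables (R : realType) (J : choiceType).
Local Notation C := R[i].
Variable b : J -> J -> C.
Hypothesis b_onb : orthonormal_basis b.

Lemma onb_sum k m : has_sum (fun j => b k j * (b m j)^*) (k == m)%:R.
Proof.
have [bl2 bE _] := b_onb.
have [[M M0 kM] [N N0 mN]] := ((l2P (b k)).1 (bl2 k), (l2P (b m)).1 (bl2 m)).
have [+ _] := l2_product M0 N0 kM (l2_boundJ mN).
by rewrite -/(inner (b k) (b m)) bE.
Qed.

Lemma onb_sum1 k : has_sum (fun j => (cmod (b k j) ^+ 2)%:C%C) 1.
Proof.
have := onb_sum k k; rewrite eqxx; congr has_sum.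
by apply/funext => j; rewrite sqr_cmod.
Qed.

Lemma onb_l2_bound k : l2_bound (b k) 1.
Proof.
by move=> F; rewrite expr1n (has_sum_ge0_ub _ _ (onb_sum1 k))// => j; exact: sqr_ge0.
Qed.

Definition comb (F : {fset J}) (d : J -> C) : J -> C := fun j => \sum_(k <- F) d k * b k j.

(** Pythagoras: the squared modulus is expanded into a double sum over [F] and summed over [j] by
    orthonormality. *)
Lemma comb_l2_bound (F : {fset J}) (d : J -> C) (a : R) : \sum_(k <- F) cmod (d k) ^+ 2 <= a ^+ 2 -> l2_bound (comb F d) a.
Proof.
move=> da E; apply: le_trans da.
have : has_sum (fun j => (cmod (comb F d j) ^+ 2)%:C%C)
    (\sum_(k <- F) \sum_(m <- F) d k * (d m)^* * (k == m)%:R).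
  have := has_sum_sum F (fun k => has_sum_sum F (fun m =>
    has_sumZ (d k * (d m)^*) (onb_sum k m))).
  congr has_sum; apply/funext => j.
  rewrite sqr_cmod /comb rmorph_sum big_distrlr /=.
  by apply: eq_bigr => k _; apply: eq_bigr => m _; rewrite rmorphM mulrACA.
move=> /(has_sum_ge0_ub E (fun j => sqr_ge0 _)) /le_trans; apply.
rewrite Re_sum le_eqVlt; apply/orP; left; apply/eqP; apply: eq_big_seq => k kF.
rewrite (bigD1_seq k)//= big1 ?addr0 => [|m /negbTE mk]; last by rewrite eq_sym mk mulr0.
by rewrite eqxx mulr1 -sqr_cmod.
Qed.

(** With [s] the partial sum, the combination with coefficients conj b_k(l) has entry [s] at [l] and
    norm at most sqrt s, so s^2 <= s. *)
Lemma bessel_unit l : l2_bound (fun k => b k l) 1.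
Proof.
move=> F; set s := \sum_(k <- F) _.
have s0 : 0 <= s by apply: sumr_ge0 => k _; exact: sqr_ge0.
have : l2_bound (comb F (fun k => (b k l)^*)) (Num.sqrt s).
  by apply: comb_l2_bound; rewrite sqr_sqrtr//; under eq_bigr do rewrite cmodJ.
move=> /(_ [fset l]%fset); rewrite big_seq_fset1 sqr_sqrtr//.
have -> : comb F (fun k => (b k l)^*) l = s%:C%C.
  by rewrite /s rmorph_sum /=; apply: eq_bigr => k _; rewrite sqr_cmod mulrC.
rewrite cmod_real ger0_norm// expr1n; have [//|s1] := leP s 1.
by rewrite expr2 ger_pMl ?(lt_trans ltr01)// leNgt s1.
Qed.

Definition series (d : J -> C) : J -> C := fun j => csum (fun k => d k * b k j).

Lemma series_sum d a j : 0 <= a -> l2_bound d a -> has_sum (fun k => d k * b k j) (series d j).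
Proof. by move=> a0 da; have [] := l2_product a0 ler01 da (bessel_unit j). Qed.

(** Pairing with finitely many entries commutes with the series, whose partial sums are the vectors
    [comb F d] of known norm. *)
Lemma series_l2_bound d a : 0 <= a -> l2_bound d a -> l2_bound (series d) a.
Proof.
move=> a0 da; apply: l2_dual => // y e E e0 ye yE.
have H : has_sum (fun k => \sum_(j <- E) y j * (d k * b k j)) (\sum_(j <- E) y j * series d j).
  by apply: has_sum_sum => j; apply: has_sumZ; apply: series_sum da.
under eq_bigr do rewrite mulrC.
apply: (has_sum_bound H) => F; rewrite exchange_big /=.
under eq_bigr do rewrite -mulr_sumr.
apply: le_trans (cmod_sum _ _ _) _; under eq_bigr do rewrite cmodM mulrC.
exact: (sum_cmodM_le _ a0 e0 (comb_l2_bound (da F)) ye).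
Qed.

Definition tail (F : {fset J}) (d : J -> C) : J -> C := fun k => if k \in F then 0 else d k.

Lemma tail_l2_bound F d a : l2_bound d a -> l2_bound (tail F d) a.
Proof.
move=> da G; apply: le_trans (da G); apply: ler_sum => k _; rewrite /tail.
by case: ifP => // _; rewrite cmod0 expr0n sqr_ge0.
Qed.

Lemma tail_small d a e : l2_bound d a -> 0 < e ->
  exists F0, forall F, (F0 `<=` F)%fset -> l2_bound (tail F d) e.
Proof.
move=> da e0; have [l dl] := has_sum_ge0 (fun k => sqr_ge0 (cmod (d k))) da.
(* Two partial sums within e^2/2 of the limit differ by less than e^2, and the difference is a
   square sum over the tail. *)
have e20 : 0 < e ^+ 2 / 2 by rewrite divr_gt0// exprn_gt0.
have [F0 F0P] := net_lim_Re dl e20; exists F0 => F F0F G.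
have GF : (F `<=` F `|` G)%fset by exact: fsubsetUl.
have := F0P _ (fsubset_trans F0F GF); have := F0P _ F0F.
rewrite -!rmorph_sum /= (sum_fset_split _ GF).
have : \sum_(j <- G) cmod (tail F d j) ^+ 2 <=
    \sum_(j <- ((F `|` G) `\` F)%fset) cmod (d j) ^+ 2.
  rewrite (bigID (fun j => j \in F)) /= big1 ?add0r; last first.
    by move=> j jF; rewrite /tail jF cmod0 expr0n.
  rewrite big_fset_condE le_eqVlt; apply/orP; left; apply/eqP.
  have -> : [fset j in G | j \notin F]%fset = ((F `|` G) `\` F)%fset.
    by apply/fsetP => j; rewrite !inE; case: (j \in F); rewrite ?andbF ?andbT.
  by apply: eq_big_seq => j; rewrite !inE /tail => /andP[/negbTE ->].
by rewrite !ltr_norml; lra.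
Qed.

Lemma series_split F d a j : 0 <= a -> l2_bound d a ->
  series d j = comb F d j + series (tail F d) j.
Proof.
move=> a0 da; apply: (has_sum_unique (series_sum j a0 da)).
have H1 : has_sum (fun k => (if k \in F then d k else 0) * b k j) (comb F d j).
  have -> : comb F d j = \sum_(k <- F) (if k \in F then d k else 0) * b k j.
    by apply: eq_big_seq => k ->.
  by apply: has_sum_fin => k /negbTE ->; rewrite mul0r.
have := has_sumD H1 (series_sum j a0 (tail_l2_bound F da)).
congr has_sum; apply/funext => k; rewrite /tail -mulrDl.
by case: ifP; rewrite ?addr0 ?add0r.
Qed.

Lemma series_coef d a m : 0 <= a -> l2_bound d a -> inner (series d) (b m) = d m.
Proof.
move=> a0 da; apply/eqP; rewrite -subr_eq0; apply/eqP/eq0_cmod_lt => e e0.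
have e20 : 0 < e / 2 by rewrite divr_gt0.
(* Once [m] lies in [F], the finite part contributes exactly [d m] and the tail at most e/2. *)
have [F0 F0P] := tail_small da e20; pose F := (m |` F0)%fset.
have tF : l2_bound (tail F d) (e / 2) by apply: F0P; exact: fsubsetU1.
have [Ht Hb] := l2_product (ltW e20) ler01 (series_l2_bound (ltW e20) tF) (l2_boundJ (onb_l2_bound m)).
have Hc : has_sum (fun j => comb F d j * (b m j)^*) (d m).
  have := has_sum_sum F (fun k => has_sumZ (d k) (onb_sum k m)).
  rewrite (big_fsetD1 m) ?fset1U1//= eqxx mulr1 big1_fset ?addr0; last first.
    by move=> k; rewrite !inE => /andP[/negbTE -> _] _; rewrite mulr0.
  congr has_sum; apply/funext => j; rewrite /comb mulr_suml.
  by apply: eq_bigr => k _; rewrite mulrA.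
have H : has_sum (fun j => series d j * (b m j)^*)
    (d m + csum (fun j => series (tail F d) j * (b m j)^*)).
  have := has_sumD Hc Ht; congr has_sum; apply/funext => j.
  by rewrite -mulrDl -(series_split _ _ a0 da).
rewrite /inner (has_sum_csum H) addrC addKr (le_lt_trans Hb)// mulr1.
by move: e0; lra.
Qed.

(** The difference [z] of both sides is orthogonal to every basis vector by [series_coef], and
    totality of the basis makes it 0. *)
Lemma onb_expansion l : (fun j => (j == l)%:R) = series (fun k => (b k l)^*).
Proof.
have [_ _ btotal] := b_onb.
have c1 : l2_bound (fun k => (b k l)^*) 1 by apply: l2_boundJ; exact: bessel_unit.
have e1 := @unit_l2_bound R J l.
set w := series _; have w1 : l2_bound w 1 by exact: series_l2_bound ler01 c1.
pose z : J -> C := fun j => (j == l)%:R + -1 * w j.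
have z2 : l2_bound z (1 + cmod (-1 : C) * 1).
  by apply: l2_boundD e1 (l2_boundZ _ w1); rewrite ?mulr_ge0 ?cmod_ge0.
suff z0 : z = 0.
  apply/funext => j; have := congr1 (fun f => f j) z0; rewrite /z mulN1r => /eqP.
  by rewrite subr_eq0 => /eqP.
apply: btotal => [|m].
  by apply/l2P; exists (1 + cmod (-1 : C) * 1); rewrite ?addr_ge0 ?mulr_ge0 ?cmod_ge0.
have He : has_sum (fun j => (j == l)%:R * (b m j)^*) (b m l)^*.
  have := has_sum_unit (fun j => (b m j)^*) l.
  by congr has_sum; apply/funext => j; rewrite mulrC.
have [Hw _] := l2_product ler01 ler01 w1 (l2_boundJ (onb_l2_bound m)).
have := has_sumD He (has_sumZ (-1) Hw).
rewrite -/(inner w (b m)) (series_coef m ler01 c1) mulN1r subrr => H.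
apply: has_sum_csum; congr has_sum : H.
by apply/funext => j; rewrite /z mulrDl mulrA.
Qed.

(* The diagonal entry at l of an operator with row h there and eigenvalues mu. *)
Lemma onb_diagonal (h mu : J -> C) (M : R) l : 0 <= M -> l2_bound h M ->
  (forall k, csum (fun j => h j * b k j) = mu k * b k l) ->
  net_lim (fun F => \sum_(k <- F) mu k * (cmod (b k l) ^+ 2)%:C%C) (h l).
Proof.
move=> M0 hM hb e e0.
have c1 : l2_bound (fun k => (b k l)^*) 1 by apply: l2_boundJ; exact: bessel_unit.
have d0 : 0 < e / (M + 1) by rewrite divr_gt0// ltr_wpDl.
have [F0 F0P] := tail_small c1 d0; exists F0 => F /F0P tF.
have [Ht Hb] := l2_product M0 (ltW d0) hM (series_l2_bound (ltW d0) tF).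
have He := has_sum_unit h l.
have Hc : has_sum (fun j => h j * comb F (fun k => (b k l)^*) j)
    (\sum_(k <- F) mu k * (cmod (b k l) ^+ 2)%:C%C).
  have row k : has_sum (fun j => h j * b k j) (mu k * b k l).
    by rewrite -hb; have [] := l2_product M0 ler01 hM (onb_l2_bound k).
  have := has_sum_sum F (fun k => has_sumZ (b k l)^* (row k)).
  congr has_sum.
    apply/funext => j; rewrite /comb mulr_sumr; apply: eq_bigr => k _.
    by rewrite mulrCA.
  by apply: eq_bigr => k _; rewrite sqr_cmod; ring.
have H : has_sum (fun j => h j * (j == l)%:R)
    (\sum_(k <- F) mu k * (cmod (b k l) ^+ 2)%:C%C +
     csum (fun j => h j * series (tail F (fun k => (b k l)^*)) j)).
  have := has_sumD Hc Ht; congr has_sum; apply/funext => j.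
  rewrite -mulrDr -(series_split _ _ ler01 c1).
  by rewrite -onb_expansion.
rewrite (has_sum_unique He H) opprD addNKr cmodN (le_lt_trans Hb)//.
by rewrite mulrA ltr_pdivrMr ?ltr_wpDl// mulrC ltr_pM2l// ltrDl.
Qed.

End OrthonormalBasis.

(** * Entries of trace class matrices *)

Section TraceClassEntries.
Variables (R : realType) (J : choiceType).
Local Notation C := R[i].
Implicit Types A P : J -> J -> C.

Lemma op_bound_col A M l : 0 <= M -> op_bound A M -> l2_bound (fun i => A i l) M.
Proof.
move=> M0 AM; have e1 := @unit_l2_bound R J l.
have [_] := AM _ 1 ler01 e1; rewrite mulr1; congr l2_bound.
by apply/funext => i; apply: has_sum_csum; exact: has_sum_unit.
Qed.

Lemma gram_sum A M j l : 0 <= M -> op_bound A M ->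
  has_sum (fun i => (A i j)^* * A i l) (mulop (adj A) A j l).
Proof.
move=> M0 AM; have [] // := l2_product M0 M0 (l2_boundJ (op_bound_col j M0 AM)) (op_bound_col l M0 AM).
Qed.

(** The row tested on a finitely supported [y] is the inner product of [A y] with column [j] of [A],
    of norms at most M a and M. *)
Lemma gram_row A M j : 0 <= M -> op_bound A M -> l2_bound (mulop (adj A) A j) (M * M).
Proof.
move=> M0 AM; apply: l2_dual; first exact: mulr_ge0.
move=> y a F a0 ya yF; have [_ Ay] := AM y a a0 ya.
have [_] := l2_product M0 (mulr_ge0 M0 a0) (l2_boundJ (op_bound_col j M0 AM)) Ay.
rewrite mulrA; congr (_ <= _); congr cmod; apply: has_sum_csum.
have := has_sum_sum F (fun l => has_sumZ (y l) (gram_sum j l M0 AM)).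
congr has_sum; last by apply: eq_bigr => l _; rewrite mulrC.
apply/funext => i; rewrite /mulv (@has_sum_csum _ _ _ (\sum_(l <- F) A i l * y l)).
  by rewrite mulr_sumr; apply: eq_bigr => l _; rewrite mulrC mulrA.
by apply: has_sum_fin => l /yF ->; rewrite mulr0.
Qed.

(** Here [P] is |A|, with eigenvalues s_k = sqrt lam_k. Each s_k is the sum over l of s_k
    |b_k(l)|^2, which is one term in the expansion of the diagonal entry of [P] at l, so s_k <= tau.
    Then |a_ij|^2 is at most the entry of A^* A at (j, j), which is sum_k lam_k |b_k(j)|^2 <= tau^2
    by Bessel. *)
Lemma op_power_entry A P M (tau : R) i j : 0 <= M -> op_bound A M ->
  op_power (mulop (adj A) A) (1 / 2) P ->
  (forall F : {fset J}, \sum_(l <- F) Re (P l l) <= tau) -> cmod (A i j) <= tau.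
Proof.
move=> M0 AM [/opnorm_lty[N N0 PN] [b [lam [onb lam0 Hb Pb]]]] trP.
have tau0 : 0 <= tau by have := trP fset0; rewrite big_seq_fset0.
pose s k := Num.sqrt (lam k).
have {}Pb k : mulv P (b k) = (s k)%:C%C *: b k.
  by rewrite Pb div1r powR12_sqrt.
have Pdiag l : net_lim (fun F => \sum_(k <- F) (s k)%:C%C * (cmod (b k l) ^+ 2)%:C%C) (P l l).
  apply: (onb_diagonal onb N0 (op_bound_row l N0 PN)) => k.
  exact: (congr1 (fun f => f l) (Pb k)).
have Hdiag : net_lim (fun F => \sum_(k <- F) (lam k)%:C%C * (cmod (b k j) ^+ 2)%:C%C)
    (mulop (adj A) A j j).
  apply: (onb_diagonal onb (mulr_ge0 M0 M0) (gram_row j M0 AM)) => k.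
  exact: (congr1 (fun f => f j) (Hb k)).
have term_ge0 k l : 0 <= s k * cmod (b k l) ^+ 2 by rewrite mulr_ge0 ?sqrtr_ge0 ?sqr_ge0.
have ReE (F : {fset J}) (r : J -> R) l : Re (\sum_(k <- F) (r k)%:C%C * (cmod (b k l) ^+ 2)%:C%C)
    = \sum_(k <- F) r k * cmod (b k l) ^+ 2.
  by under eq_bigr do rewrite -rmorphM; rewrite -rmorph_sum.
have s_le k : s k <= tau.
  have := net_lim_le (M := tau) (has_sumZ (s k)%:C%C (onb_sum1 onb k)).
  rewrite mulr1 /=; apply => F; under eq_bigr do rewrite -rmorphM.
  rewrite -rmorph_sum /=; apply: le_trans (trP F); apply: ler_sum => l _.
  apply: (net_lim_ge (F0 := [fset k]%fset) (Pdiag l)) => G kG; rewrite ReE.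
  have := ler_sum_fset (term_ge0^~ l) kG; by rewrite big_seq_fset1.
have : Re (mulop (adj A) A j j) <= tau ^+ 2.
  apply: (net_lim_le Hdiag) => F; rewrite ReE.
  apply: (@le_trans _ _ (\sum_(k <- F) tau ^+ 2 * cmod (b k j) ^+ 2)).
    apply: ler_sum => k _; apply: ler_wpM2r; first exact: sqr_ge0.
    by rewrite -[lam k]sqr_sqrtr// ler_pXn2r ?nnegrE ?sqrtr_ge0 ?s_le.
  rewrite -mulr_sumr -[leRHS]mulr1 ler_wpM2l ?sqr_ge0//.
  by have := bessel_unit onb j F; rewrite expr1n.
have : has_sum (fun i => (cmod (A i j) ^+ 2)%:C%C) (mulop (adj A) A j j).
  have := gram_sum j j M0 AM; congr has_sum; apply/funext => k.
  by rewrite sqr_cmod mulrC.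
move=> /(has_sum_ge0_ub [fset i]%fset (fun i => sqr_ge0 _)); rewrite big_seq_fset1.
move=> H1 H2; have := le_trans H1 H2.
by rewrite ler_pXn2r ?nnegrE ?cmod_ge0.
Qed.

Lemma schatten_trace_ge0 (p : R) A : (0 <= schatten_trace p A)%E.
Proof.
(* [\esum] is a supremum over finite sets, and the empty one contributes 0 whatever the signs on the
   diagonal of [P]. *)
apply: le_ereal_inf_tmp => _ [P _ <-]; apply: esum_ge; exists set0; first exact: fsets_set0.
by rewrite fsbig_set0.
Qed.

(** The norm is an infimum over the square roots [P] of the Gram matrix, and the trace of each of
    them, finite or not, bounds the entry. *)
Lemma schatten1_entry A i j : schatten 1%:E A -> ((cmod (A i j))%:E <= schatten_norm 1%:E A)%E.
Proof.
move=> [[/opnorm_lty[M M0 AM] _] _]; rewrite /schatten_norm invr1 poweRe1 ?schatten_trace_ge0//.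
apply: le_ereal_inf_tmp => _ [P PH <-].
have [e|e] := leP +oo%E (\esum_(k in [set: J]) (Re (P k k))%:E)%E.
  by apply: le_trans e; rewrite leey.
have e0 : (0 <= \esum_(k in [set: J]) (Re (P k k))%:E)%E.
  by apply: esum_ge; exists set0; [exact: fsets_set0|rewrite fsbig_set0].
have efin : (\esum_(k in [set: J]) (Re (P k k))%:E)%E \is a fin_num by rewrite ge0_fin_numE.
rewrite -(fineK efin) lee_fin; apply: op_power_entry M0 AM PH _.
by apply/esum_leP; rewrite fineK.
Qed.

End TraceClassEntries.


(** * Invariance of the Schatten and operator space norms under sign changes *)

Section FlipNorms.
Variable R : realType.
Local Notation C := R[i].

Definition sgnv (J : Type) (s : J -> bool) (x : J -> C) : J -> C := fun j => (-1) ^+ s j * x j.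

Lemma sgnvK (J : Type) (s : J -> bool) : involutive (sgnv s).
Proof.
by move=> x; apply/funext => j; rewrite /sgnv mulrA -signr_addb addbb mul1r.
Qed.

Lemma l2norm_sgnv (J : choiceType) (s : J -> bool) (x : J -> C) : l2norm (sgnv s x) = l2norm x.
Proof.
rewrite /l2norm; congr (_ `^ _)%E; apply: eq_esum => j _.
by rewrite /sgnv cmodM cmod_sign mul1r.
Qed.

Lemma l2_bound_sgnv (J : choiceType) (s : J -> bool) (x : J -> C) a :
  l2_bound x a -> l2_bound (sgnv s x) a.
Proof. by move=> xa F; under eq_bigr do rewrite /sgnv cmodM cmod_sign mul1r. Qed.

Section Rectangular.
Variables J K : choiceType.
Implicit Types (A : J -> K -> C) (x : K -> C).

Lemma mulv_flip_sum A M s s' x a j : op_bound A M -> 0 <= a -> l2_bound x a ->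
  has_sum (fun k => flip s s' A j k * x k) (sgnv s (mulv A (sgnv s' x)) j).
Proof.
move=> AM a0 xa; have [Ax _] := AM _ _ a0 (l2_bound_sgnv s' xa).
have := has_sumZ ((-1) ^+ s j) (Ax j); congr has_sum; apply/funext => k.
by rewrite flip_signs /sgnv [A j k * _]mulrCA -!mulrA.
Qed.

Lemma mulv_flip A M s s' x a : op_bound A M -> 0 <= a -> l2_bound x a ->
  mulv (flip s s' A) x = sgnv s (mulv A (sgnv s' x)).
Proof.
by move=> AM a0 xa; apply/funext => j; apply: has_sum_csum; exact: mulv_flip_sum AM a0 xa.
Qed.

Lemma op_bound_flip A M s s' : op_bound A M -> op_bound (flip s s' A) M.
Proof.
move=> AM x a a0 xa; rewrite (mulv_flip s s' AM a0 xa); split=> [j|].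
  exact: mulv_flip_sum AM a0 xa.
by apply: l2_bound_sgnv; have [] := AM _ _ a0 (l2_bound_sgnv s' xa).
Qed.

(** One inequality for all matrices suffices because [flip] is an involution; the other norms are
    handled likewise. *)
Lemma opnorm_flip A s s' : opnorm (flip s s' A) = opnorm A.
Proof.
have le (B : J -> K -> C) : (opnorm (flip s s' B) <= opnorm B)%E.
  have [By|] := ltP (opnorm B) +oo%E; last by apply: le_trans; rewrite leey.
  have B0 := opnorm_ge0 B; have Bfin : opnorm B \is a fin_num by rewrite ge0_fin_numE.
  rewrite -(fineK Bfin); apply/opnorm_leP; first exact: fine_ge0.
  apply: op_bound_flip; apply/opnorm_leP; first exact: fine_ge0.
  by rewrite fineK.
apply/eqP; rewrite eq_le; apply/andP; split; first exact: le.
by have := le (flip s s' A); rewrite flipK.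
Qed.

(** Compactness of [A] is applied to the sequence with the column signs, and the limit [y] receives
    the row signs. *)
Lemma compact_op_flip A s s' : compact_op A -> compact_op (flip s s' A).
Proof.
move=> [Ay Ac]; split; first by rewrite opnorm_flip.
move=> x x1; have [M M0 AM] := opnorm_lty Ay.
have [|f [y [fhomo yl2 fy]]] := Ac (fun n => sgnv s' (x n)).
  by move=> n; rewrite l2norm_sgnv.
exists f, (sgnv s y); split=> //; first by rewrite /l2 /= l2norm_sgnv.
rewrite (_ : (fun n => _) = fun n => l2norm (mulv A (sgnv s' (x (f n))) - y))//.
apply/funext => n.
have /(@l2norm_leP _ _ _ 1) xb := x1 (f n).
rewrite (mulv_flip s s' AM ler01 (xb ler01)) -[LHS](l2norm_sgnv s).
congr l2norm; apply/funext => j; rewrite /sgnv !fctE mulrBr mulrA -signr_addb addbb mul1r.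
by rewrite mulrA -signr_addb addbb mul1r.
Qed.

End Rectangular.

Section Square.
Variable J : choiceType.
Implicit Types A P H : J -> J -> C.

(** Row signs square to 1 inside A^* A; the column signs remain, on both sides, so the Gram matrix
    is conjugated by a diagonal unitary. *)
Lemma gram_flip A M s s' : 0 <= M -> op_bound A M ->
  mulop (adj (flip s s' A)) (flip s s' A) = flip s' s' (mulop (adj A) A).
Proof.
move=> M0 AM; apply/funext => j; apply/funext => l; apply: has_sum_csum.
have := has_sumZ ((-1) ^+ (s' j (+) s' l)) (gram_sum j l M0 AM).
congr has_sum; apply/funext => i; rewrite /adj /flip rmorphM rmorph_sign /=.
rewrite mulrACA -signr_addb; congr (_ * _); congr (_ ^+ _).
by case: (s i); case: (s' j); case: (s' l).
Qed.

Lemma orthonormal_basis_sgnv (b : J -> J -> C) s : orthonormal_basis b ->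
  orthonormal_basis (fun k => sgnv s (b k)).
Proof.
have inner_sgnv x y : inner (sgnv s x) (sgnv s y) = inner x y.
  rewrite /inner; congr csum; apply/funext => j; rewrite /sgnv rmorphM rmorph_sign /=.
  by rewrite mulrACA -signr_addb addbb mul1r.
move=> [bl2 bE bt]; split=> [k|k m|x xl2 xb].
- by rewrite /l2 /= l2norm_sgnv; exact: bl2.
- by rewrite inner_sgnv.
- rewrite -[x](sgnvK s) (bt (sgnv s x)).
  + by apply/funext => j; rewrite /sgnv mulr0.
  + by rewrite /l2 /= l2norm_sgnv.
  + by move=> k; rewrite -inner_sgnv sgnvK.
Qed.

Lemma mulv_flip_eigen H s (v : J -> C) (a : C) :
  (forall j, has_sum (fun k => H j k * v k) (mulv H v j)) -> mulv H v = a *: v ->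
  mulv (flip s s H) (sgnv s v) = a *: sgnv s v.
Proof.
move=> Hv Hva; apply/funext => j; apply: has_sum_csum.
have := has_sumZ ((-1) ^+ s j) (Hv j); rewrite Hva; congr has_sum.
  apply/funext => k; rewrite flip_signs /sgnv -[RHS]mulrA mulrACA.
  by rewrite -signr_addb addbb mul1r.
by rewrite /sgnv !fctE /GRing.scale /= mulrCA.
Qed.

(** Conjugation by signs moves the eigenbasis and keeps the eigenvalues, hence commutes with powers.
    [M] makes the rows of A^* A summable against the basis. *)
Lemma op_power_flip A M s (r : R) P : 0 <= M -> op_bound A M ->
  op_power (mulop (adj A) A) r P -> op_power (flip s s (mulop (adj A) A)) r (flip s s P).
Proof.
move=> M0 AM [Py [b [lam [onb lam0 Hb Pb]]]]; split; first by rewrite opnorm_flip.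
have [N N0 PN] := opnorm_lty Py.
exists (fun k => sgnv s (b k)), lam; split=> // [|k|k].
- exact: orthonormal_basis_sgnv.
- apply: mulv_flip_eigen (Hb k) => j.
  by have [] := l2_product (mulr_ge0 M0 M0) ler01 (gram_row j M0 AM) (onb_l2_bound onb k).
- apply: mulv_flip_eigen (Pb k) => j.
  by have [+ _] := PN _ _ ler01 (onb_l2_bound onb k); apply.
Qed.

Lemma schatten_trace_flip A (p : R) s s' : (opnorm A < +oo)%E ->
  schatten_trace p (flip s s' A) = schatten_trace p A.
Proof.
have le (B : J -> J -> C) : (opnorm B < +oo)%E -> (schatten_trace p (flip s s' B) <= schatten_trace p B)%E.
  move=> /opnorm_lty[M M0 BM]; apply: le_ereal_inf_tmp => _ [P BP <-].
  apply: ereal_inf_lbound; exists (flip s' s' P).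
    by rewrite (gram_flip s s' M0 BM); exact: op_power_flip M0 BM BP.
  by apply: eq_esum => j _; rewrite /flip addbb mul1r.
move=> Ay; apply/eqP; rewrite eq_le; apply/andP; split; first exact: le.
by have := le (flip s s' A); rewrite flipK opnorm_flip; apply.
Qed.

Lemma schatten_norm_flip (p : \bar R) A s s' : (opnorm A < +oo)%E ->
  schatten_norm p (flip s s' A) = schatten_norm p A.
Proof.
move=> Ay; case: p => [r||]; [|exact: opnorm_flip|exact: opnorm_flip].
exact: (congr1 (fun e => (e `^ r^-1)%E) (schatten_trace_flip r s s' Ay)).
Qed.

Lemma schatten_flip (p : \bar R) A s s' : schatten p A -> schatten p (flip s s' A).
Proof.
move=> [Ac Ap]; split; first exact: compact_op_flip.
by rewrite schatten_norm_flip; [exact: Ap|case: Ac].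
Qed.

End Square.

Section OperatorSpaceNorms.
Variable I : choiceType.
Local Notation mat := (I -> I -> C).
Variables s s' : I -> bool.

Definition mflip (J : Type) (x : J -> J -> mat) : J -> J -> mat := fun i j => flip s s' (x i j).

Lemma mflipK (J : Type) : involutive (@mflip J).
Proof. by move=> x; apply/funext => i; apply/funext => j; rewrite /mflip flipK. Qed.

(** Signs on [I] become signs on [J * I] that ignore the first coordinate. *)
Lemma mnorm_flip_oo (J : finType) (x : J -> J -> mat) :
  @mnorm R (opSchatten_oo R I) J (mflip x) = @mnorm R (opSchatten_oo R I) J x.
Proof.
rewrite /= -[RHS](opnorm_flip _ (fun a => s a.2) (fun a => s' a.2)).
by congr opnorm.
Qed.

Lemma pairing_flip (A B : mat) : pairing (flip s s' A) B = pairing A (flip s s' B).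
Proof.
rewrite /pairing /trace; congr csum; apply/funext => i.
apply: (congr1 (@csum R I)); apply/funext => j; rewrite /trmat /flip.
by rewrite mulrCA mulrA.
Qed.

(** The S_1 norm tests on the unit balls of M_K(S_oo), which are invariant under sign changes; the
    pairing moves the signs onto the test matrices. *)
Lemma mnorm_flip_1 (J : finType) (x : J -> J -> mat) :
  @mnorm R (opSchatten_1 R I) J (mflip x) = @mnorm R (opSchatten_1 R I) J x.
Proof.
have le y : (@mnorm R (opSchatten_1 R I) J (mflip y) <= @mnorm R (opSchatten_1 R I) J y)%E.
  apply: ge_ereal_sup => _ [K [z [zoo z1 ->]]]; apply: ereal_sup_ubound.
  exists K, (mflip z); split.
  - move=> i j; exact: schatten_flip (zoo i j).
  - by rewrite mnorm_flip_oo.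
  - by congr mnorm; apply/funext => a; apply/funext => b; rewrite /mflip pairing_flip.
apply/eqP; rewrite eq_le; apply/andP; split; first exact: le.
by have := le (mflip x); rewrite mflipK.
Qed.

End OperatorSpaceNorms.

Section InterpolationInvariance.
Variables (V : lmodType C) (N0 N1 : V -> \bar R) (D : V -> V).
Hypothesis D_lin : forall a u v, D (a *: u + v) = a *: D u + D v.
Hypothesis DK : involutive D.
Hypothesis D0 : forall v, N0 (D v) = N0 v.
Hypothesis D1 : forall v, N1 (D v) = N1 v.

Lemma involution_sub u v : D (u - v) = D u - D v.
Proof. by rewrite addrC -scaleN1r D_lin scaleN1r addrC. Qed.

Lemma involution_scale a u : D (a *: u) = a *: D u.
Proof.
have D00 : D 0 = 0 by have := involution_sub 0 0; rewrite !subrr.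
by rewrite -[a *: u]addr0 D_lin D00 addr0.
Qed.

Lemma sumnorm_inv v : sumnorm N0 N1 (D v) = sumnorm N0 N1 v.
Proof.
have le u : (sumnorm N0 N1 (D u) <= sumnorm N0 N1 u)%E.
  apply: le_ereal_inf_tmp => _ [a _ <-]; apply: ereal_inf_lbound; exists (D a) => //.
  by rewrite -involution_sub D0 D1.
apply/eqP; rewrite eq_le; apply/andP; split; first exact: le.
by have := le (D v); rewrite DK.
Qed.

(** Boundedness, continuity and holomorphy are stated through norms of linear expressions in values
    of [f], and the linear map [D] preserves the two end norms and thus [sumnorm]. *)
Lemma interp_fun_inv f : interp_fun N0 N1 f -> interp_fun N0 N1 (D \o f).
Proof.
have bnd T N : (forall v, N (D v) = N v) -> bounded_on T N f -> bounded_on T N (D \o f).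
  by move=> DN [M fM]; exists M => z Tz; rewrite DN fM.
have cont T N : (forall v, N (D v) = N v) -> cont_on T N f -> cont_on T N (D \o f).
  move=> DN fc z Tz e e0; have [d d0 fd] := fc z Tz e e0.
  by exists d => // w Tw wz; rewrite /= -involution_sub DN fd.
move=> [[fb fc] fh [fb0 fc0] [fb1 fc1]]; split.
- by split; [apply: bnd fb|apply: cont fc]; exact: sumnorm_inv.
- move=> z z01; have [v fv] := fh z z01; exists (D v) => e e0.
  have [d d0 fd] := fv e e0; exists d => // w wz wd.
  by rewrite /= -involution_sub -involution_scale -involution_sub sumnorm_inv fd.
- by split; [exact: bnd fb0|exact: cont fc0].
- by split; [exact: bnd fb1|exact: cont fc1].
Qed.

Lemma interp_norm_inv theta v : interp_norm N0 N1 theta (D v) = interp_norm N0 N1 theta v.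
Proof.
have le u : (interp_norm N0 N1 theta (D u) <= interp_norm N0 N1 theta u)%E.
  apply: le_ereal_inf_tmp => _ [f [fi fu] <-]; apply: ereal_inf_lbound.
  exists (D \o f); first by split; [exact: interp_fun_inv|rewrite /= fu].
  rewrite /interp_fun_norm; congr (maxe (ereal_sup _) (ereal_sup _)).
    by apply: eq_imagel => z _; rewrite /= D0.
  by apply: eq_imagel => z _; rewrite /= D1.
apply/eqP; rewrite eq_le; apply/andP; split; first exact: le.
by have := le (D v); rewrite DK.
Qed.

End InterpolationInvariance.

Section OpSchattenFlip.
Variables (I : choiceType) (s s' : I -> bool).
Local Notation mat := (I -> I -> C).

Lemma mnorm_ext_eq (E : mspace R) (J : finType) (x y : J -> J -> E) :
  (mdomM x <-> mdomM y) -> mnorm x = mnorm y -> mnorm_ext x = mnorm_ext y.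
Proof. by rewrite /mnorm_ext => /propext -> ->. Qed.

Lemma schattenM_flip (p : \bar R) (J : Type) (x : J -> J -> mat) :
  (forall i j, schatten p (mflip s s' x i j)) <-> (forall i j, schatten p (x i j)).
Proof.
split=> H i j; last exact: schatten_flip (H i j).
by have := schatten_flip s s' (H i j); rewrite /mflip flipK.
Qed.

Lemma mnorm_flip (p : \bar R) (J : finType) (x : J -> J -> mat) :
  @mnorm R (opSchatten I p) J (mflip s s' x) = @mnorm R (opSchatten I p) J x.
Proof.
case: p => [r||]; rewrite /opSchatten /mnorm; last 2 first.
- exact: mnorm_flip_oo.
- exact: mnorm_flip_oo.
case: ifP => _; first exact: mnorm_flip_1.
apply: interp_norm_inv => [a u v||v|v].
- by apply/funext => i; apply/funext => j; rewrite /mflip !fctE flip_linear.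
- exact: mflipK.
- exact: (@mnorm_ext_eq (opSchatten_oo R I) J _ _ (schattenM_flip +oo%E v) (mnorm_flip_oo s s' v)).
- exact: (@mnorm_ext_eq (opSchatten_1 R I) J _ _ (schattenM_flip 1%:E v) (mnorm_flip_1 s s' v)).
Qed.

End OpSchattenFlip.

End FlipNorms.


(** * Matrix units belong to the Schatten classes *)

Section MatrixUnitsInSchatten.
Variables (R : realType) (I : choiceType).
Local Notation C := R[i].
Implicit Types (x : I -> C) (k l : I).

Lemma mulv_delta_sum k l x j : has_sum (fun i => delta k l j i * x i) ((j == k)%:R * x l).
Proof.
have := has_sumZ (j == k)%:R (has_sum_unit x l); congr has_sum; apply/funext => i.
by rewrite /delta; case: (j == k); rewrite ?mul0r ?mul1r//= mulrC.
Qed.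

Lemma mulv_delta k l x : mulv (delta k l) x = fun j => (j == k)%:R * x l.
Proof. by apply/funext => j; apply: has_sum_csum; exact: mulv_delta_sum. Qed.

Lemma l2_bound_delta k (c : C) : l2_bound (fun j => (j == k)%:R * c) (cmod c).
Proof.
have := l2_boundZ c (@unit_l2_bound R I k); rewrite mulr1.
by congr l2_bound; apply/funext => j; rewrite mulrC.
Qed.

Lemma op_bound_delta k l : op_bound (delta k l : I -> I -> C) 1.
Proof.
move=> x a a0 xa; rewrite mulv_delta; split=> [j|F]; first exact: mulv_delta_sum.
apply: le_trans (l2_bound_delta k (x l) F) _; rewrite mul1r.
by rewrite ler_pXn2r ?nnegrE ?cmod_ge0// (l2_bound_entry l a0 xa).
Qed.

Lemma increasing_seq_homo (f : nat -> nat) : increasing_seq f -> {homo f : m n / (m < n)%N}.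
Proof. by move=> fi m n; rewrite !ltnNge -(fi n m). Qed.

Lemma increasing_seq_ge (f : nat -> nat) n : increasing_seq f -> (n <= f n)%N.
Proof.
move=> fi; elim: n => // n IH; apply: leq_ltn_trans IH _.
exact: increasing_seq_homo.
Qed.

(** Bolzano-Weierstrass for the real parts, then for the imaginary parts along the first
    subsequence. *)
Lemma bounded_complex_subseq (z : nat -> C) (M : R) : (forall n, cmod (z n) <= M) ->
  exists2 f : nat -> nat, {homo f : m n / (m < n)%N} &
  exists a, (fun n => cmod (z (f n) - a)) @ \oo --> (0 : R).
Proof.
move=> zM.
have bnd (u : nat -> R) : (forall n, `|u n| <= M) -> bounded_fun u.
  move=> uM; exists M; split; first exact: num_real.
  by move=> N MN n _ /=; rewrite (le_trans (uM n))// ltW.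
have [f fi /cvg_ex[a fa]] := @bolzano_weierstrass R (fun n => Re (z n))
  (bnd _ (fun n => le_trans (Re_le_cmod _) (zM n))).
have [g gi /cvg_ex[c gc]] := @bolzano_weierstrass R (fun n => Im (z (f n)))
  (bnd _ (fun n => le_trans (Im_le_cmod _) (zM (f n)))).
exists (f \o g).
  by move=> m n mn; apply: increasing_seq_homo fi _ _ _; exact: increasing_seq_homo mn.
exists (a%:C%C + 'i%C * c%:C%C).
have fga : (fun n => Re (z (f (g n)))) @ \oo --> a.
  apply/cvgrPdist_lt => e e0; have /cvgrPdist_lt/(_ e e0)[N _ NP] := fa.
  by exists N => // n /= Nn; apply: NP => /=; exact: leq_trans Nn (increasing_seq_ge _ gi).
have : (fun n => `|Re (z (f (g n))) - a| + `|Im (z (f (g n))) - c|) @ \oo --> (0 : R).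
  rewrite -[0]addr0; apply: cvgD.
    by rewrite -(normr0 R) -(subrr a); apply: cvg_norm; apply: cvgB fga (cvg_cst _).
  by rewrite -(normr0 R) -(subrr c); apply: cvg_norm; apply: cvgB gc (cvg_cst _).
apply: squeeze_cvgr (cvg_cst 0); near=> n; rewrite cmod_ge0 /=.
apply: le_trans (cmod_le_ReIm _) _; rewrite le_eqVlt; apply/orP; left; apply/eqP.
by case: (z _) => u v /=; rewrite !(mul0r, mul1r, mulr0, subr0, addr0, add0r, opprD, oppr0).
Unshelve. all: by end_near.
Qed.

(** The matrix unit maps x to x_l e_k, so its compactness is Bolzano-Weierstrass for the scalars
    x_n(l). *)
Lemma compact_op_delta k l : compact_op (delta k l : I -> I -> C).
Proof.
split.
  have /(opnorm_leP _ ler01) := @op_bound_delta k l.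
  by move=> /le_lt_trans; apply; rewrite ltry.
move=> x x1.
have xl n : cmod (x n l) <= 1.
  by apply: l2_bound_entry => //; apply/l2norm_leP.
have [f fhomo [a fa]] := bounded_complex_subseq xl.
exists f, (fun j => (j == k)%:R * a); split=> //.
  by apply/l2P; exists (cmod a); [exact: cmod_ge0|exact: l2_bound_delta].
have : (fun n => (cmod (x (f n) l - a))%:E) @ \oo --> (0 : R)%:E.
  by apply/fine_cvgP; split=> //; near=> n.
apply: squeeze_cvge (cvg_cst 0%E); near=> n; rewrite l2norm_ge0 /=.
apply/l2norm_leP; first exact: cmod_ge0.
have := l2_bound_delta k (x (f n) l - a); congr l2_bound.
by apply/funext => j; rewrite mulv_delta !fctE mulrBr.
Unshelve. all: by end_near.
Qed.

Lemma gram_delta k l : mulop (adj (delta k l)) (delta k l) = delta l l :> (I -> I -> C).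
Proof.
apply/funext => j; apply/funext => m; apply: has_sum_csum.
have -> : delta l l j m = \sum_(i <- [fset k]%fset) adj (delta k l) j i * delta k l i m :> C.
  rewrite big_seq_fset1 /adj /delta eqxx /= rmorph_nat.
  by case: (j == l); rewrite ?mul0r ?mul1r.
by apply: has_sum_fin => i; rewrite inE /delta => /negbTE ->; rewrite mulr0.
Qed.

Lemma orthonormal_basis_unit : orthonormal_basis (fun k j : I => (j == k)%:R : C).
Proof.
have innerE x k : inner x (fun j => (j == k)%:R) = x k.
  apply: has_sum_csum; have := has_sum_unit x k; congr has_sum.
  by apply/funext => j; rewrite rmorph_nat.
split=> [k|k m|x _ x0]; last by apply/funext => k; rewrite -innerE x0.
  by apply/l2P; exists 1 => //; exact: unit_l2_bound.
by rewrite innerE eq_sym.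
Qed.

(** A projection is its own power, with the unit vectors as eigenvectors for 0 and 1; the exponent 0
    is excluded because [powR 0 0] is 1. *)
Lemma op_power_delta l (r : R) : r != 0 -> op_power (delta l l : I -> I -> C) r (delta l l).
Proof.
move=> r0; split; first by case: (compact_op_delta l l).
exists (fun k j => (j == k)%:R), (fun k => (k == l)%:R); split=> [|k|k|k].
- exact: orthonormal_basis_unit.
- exact: ler0n.
- apply/funext => j; rewrite mulv_delta !fctE /GRing.scale /= rmorph_nat.
  by case: (eqVneq k l) => [->|_]; rewrite /= ?mulr1 ?mul1r ?mulr0 ?mul0r.
- apply/funext => j; rewrite mulv_delta !fctE /GRing.scale /=.
  by case: (eqVneq k l) => [->|_]; rewrite /= ?powR1 ?powR0 ?mulr1 ?mul1r ?mulr0 ?mul0r.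
Qed.

Lemma schatten_delta (p : \bar R) k l : (forall r, p = r%:E -> r != 0) ->
  schatten p (delta k l : I -> I -> C).
Proof.
move=> p0; split; first exact: compact_op_delta.
have opy : (opnorm (delta k l : I -> I -> C) < +oo)%E by case: (compact_op_delta k l).
case: p p0 => [r|_|_]; [|exact: opy|exact: opy].
move=> /(_ r erefl) r0; rewrite /schatten_norm; apply: poweR_lty.
apply: (@le_lt_trans _ _ 1%:E); last exact: ltry.
apply: (@le_trans _ _ (\esum_(j in [set: I]) (Re (delta l l j j : C))%:E)%E).
  (* One candidate bounds the infimum: the Gram matrix [delta l l] is its own power and has trace
     1. *)
  apply: ereal_inf_lbound; exists (delta l l); last by [].
  by rewrite gram_delta; apply: op_power_delta; rewrite mulf_neq0 ?invr_neq0 ?pnatr_eq0.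
apply/esum_leP => F; rewrite -(expr1n R 2).
apply: le_trans (@unit_l2_bound R I l F); apply: ler_sum => j _.
by rewrite /delta andbb; case: (j == l); rewrite ?cmod1 ?cmod0 ?expr1n ?expr0n.
Qed.

End MatrixUnitsInSchatten.


(** * Functionals on operator spaces and on quotients *)

Section FiniteIndex.
Variable R : realType.
Local Notation C := R[i].

Lemma has_sum_fintype (K : finType) (x : K -> C) : has_sum x (\sum_k x k).
Proof.
have -> : \sum_k x k = \sum_(k <- [fset k in K]%fset) x k.
  apply: perm_big; apply: uniq_perm => [||k].
  - exact: index_enum_uniq.
  - exact: fset_uniq.
  - by rewrite mem_index_enum inE.
by apply: has_sum_fin => k; rewrite inE.
Qed.

Lemma l2_bound_comp (J K : choiceType) (h : J -> K) (x : K -> C) M :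
  injective h -> l2_bound x M -> l2_bound (x \o h) M.
Proof.
move=> hi xM F; have := xM (h @` F)%fset.
by rewrite big_imfset => [|i j _ _ /hi].
Qed.

Lemma l2_bound_unit (x : unit -> C) M : 0 <= M -> cmod (x tt) <= M -> l2_bound x M.
Proof.
move=> M0 xM F; apply: (@le_trans _ _ (\sum_(j <- [fset tt]%fset) cmod (x j) ^+ 2)).
  apply: ler_sum_fset => [j|]; first exact: sqr_ge0.
  by apply/fsubsetP => -[] _; rewrite inE.
by rewrite big_seq_fset1 ler_pXn2r ?nnegrE ?cmod_ge0.
Qed.

Lemma op_bound_row_vector (K : choiceType) (w : K -> C) M : 0 <= M -> l2_bound w M ->
  op_bound (fun (_ : unit) k => w k) M.
Proof.
move=> M0 wM x a a0 xa; have [H Hb] := l2_product M0 a0 wM xa.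
by split=> //; apply: l2_bound_unit => //; exact: mulr_ge0.
Qed.

Lemma op_bound_col_vector (K : choiceType) (y : K -> C) M : l2_bound y M ->
  op_bound (fun k (_ : unit) => y k) M.
Proof.
move=> yM x a a0 xa; have H k : has_sum (fun i : unit => y k * x i) (y k * x tt).
  have := has_sumZ (y k) (has_sum_fintype x); congr has_sum; congr (_ * _).
  by rewrite (bigD1 tt)//= big1 ?addr0// => -[].
have E : mulv (fun k (_ : unit) => y k) x = fun k => x tt * y k.
  by apply/funext => k; rewrite mulrC; exact: has_sum_csum.
split=> [k|]; first by rewrite E mulrC.
rewrite E => F; apply: le_trans (l2_boundZ (x tt) yM F) _.
have xtt := l2_bound_entry tt a0 xa.
rewrite !exprMn mulrC ler_wpM2l ?sqr_ge0//.
by rewrite ler_pXn2r ?nnegrE ?cmod_ge0.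
Qed.

Lemma op_bound_scalar (K : choiceType) (c : C) :
  op_bound (fun j k : K => (j == k)%:R * c) (cmod c).
Proof.
move=> x a a0 xa; have H j : has_sum (fun k => (j == k)%:R * c * x k) (c * x j).
  have := has_sumZ c (has_sum_unit x j); congr has_sum; apply/funext => k.
  by rewrite eq_sym; ring.
have -> : mulv (fun j k : K => (j == k)%:R * c) x = fun j => c * x j.
  by apply/funext => j; exact: has_sum_csum.
by split=> //; exact: l2_boundZ.
Qed.

Lemma op_boundZ (J K : choiceType) (A : J -> K -> C) (c : C) M : op_bound A M ->
  op_bound (fun j k => c * A j k) (cmod c * M).
Proof.
move=> AM x a a0 xa; have [Ax Axb] := AM x a a0 xa.
have H j : has_sum (fun k => c * A j k * x k) (c * mulv A x j).
  by have := has_sumZ c (Ax j); congr has_sum; apply/funext => k; rewrite mulrA.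
have -> : mulv (fun j k => c * A j k) x = fun j => c * mulv A x j.
  by apply/funext => j; exact: has_sum_csum.
by split=> //; rewrite -mulrA; exact: l2_boundZ.
Qed.

Lemma op_bound_entry (J K : choiceType) (A : J -> K -> C) M j k :
  0 <= M -> op_bound A M -> cmod (A j k) <= M.
Proof. by move=> M0 AM; apply: l2_bound_entry M0 (op_bound_row j M0 AM). Qed.

End FiniteIndex.

Lemma functional_ball (R : realType) (X : normedModType R[i]) (f : X -> R[i]) (M : R) u :
  0 <= M -> (forall a u v, f (a *: u + v) = a * f u + f v) ->
  (forall v, rnorm v <= 1 -> cmod (f v) <= M) -> cmod (f u) <= M * rnorm u.
Proof.
move=> M0 flin ball.
have flinZ a v : f (a *: v) = a * f v.
  have f0 : f 0 = 0.
    by have := flin (-1) 0 0; rewrite scaleN1r oppr0 addr0 mulN1r addNr.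
  by rewrite -[a *: v]addr0 flin f0 addr0.
have [u0|u0] := eqVneq (rnorm u) 0.
  have -> : u = 0 by apply: normr0_eq0; rewrite norm_rnorm u0.
  by rewrite -(scale0r 0) flinZ mul0r cmod0 mulr_ge0 ?rnorm_ge0.
have u_gt0 : 0 < rnorm u by rewrite lt_def u0 rnorm_ge0.
have := ball ((rnorm u)^-1%:C%C *: u).
rewrite rnormZ flinZ cmodM cmod_real gtr0_norm ?invr_gt0// mulVf// => /(_ (lexx _)).
by rewrite mulrC ler_pdivrMr.
Qed.


Section OperatorSpaces.
Variables (R : realType) (X : completeNormedModType R[i]).
Local Notation C := R[i].
Variable N : forall J : finType, (J -> J -> X) -> R.
Hypothesis N_op : operator_space N.

Lemma matrix_norm_le (J K : finType) (al : J -> K -> C) (x : K -> K -> X) (be : K -> J -> C) a c b :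
  0 <= a -> 0 <= b -> 0 <= c -> op_bound al a -> op_bound be b -> N x <= c ->
  N (mxmul3 al x be) <= a * c * b.
Proof.
move=> a0 b0 c0 /(opnorm_leP _ a0) ala /(opnorm_leP _ b0) beb xc.
have [_ _ Nm _] := N_op; rewrite -lee_fin; apply: le_trans (Nm J K al x be) _.
apply: (@le_trans _ _ ((a * c)%:E * opnorm be)%E).
  apply: lee_wpmul2r; first exact: opnorm_ge0.
  rewrite EFinM; apply: (@le_trans _ _ (opnorm al * c%:E)%E).
    by apply: lee_wpmul2l; [exact: opnorm_ge0|rewrite lee_fin].
  by apply: lee_wpmul2r => //; rewrite lee_fin.
by rewrite [leRHS]EFinM; apply: lee_wpmul2l => //; rewrite lee_fin mulr_ge0.
Qed.

(** Scaling is multiplication by the scalar matrices r^-1 Id and Id, to which Ruan's axiom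
    applies. *)
Lemma matrix_norm_scale (K : finType) (x : K -> K -> X) (r : R) : 0 < r -> N x <= r ->
  N (fun i j => (r^-1)%:C%C *: x i j) <= 1.
Proof.
move=> r0 xr; have := matrix_norm_le (J := K) (c := r) (cmod_ge0 (r^-1)%:C%C) (cmod_ge0 1) (ltW r0)
  (op_bound_scalar _) (op_bound_scalar _) xr.
rewrite cmod1 mulr1 cmod_real gtr0_norm ?invr_gt0// mulVf ?gt_eqF//.
congr (_ <= _); congr N; apply/funext => i; apply/funext => j.
rewrite /mxmul3 (bigD1 i)//= [X in _ + X]big1 ?addr0 => [|k /negbTE ki]; last first.
  by rewrite big1// => l _; rewrite eq_sym ki !mul0r scale0r.
rewrite (bigD1 j)//= big1 ?addr0 => [|l /negbTE lj]; last first.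
  by rewrite lj !mul0r mulr0 scale0r.
by rewrite !eqxx !mul1r mulr1.
Qed.

(* w^T [f(x_ik)] y = f(w^T x y), and w^T x y is controlled by Ruan's axioms: a bounded
   functional is completely bounded with the same norm. *)
Lemma bounded_functional_amplified (f : X -> C) M (K : finType) (x : K -> K -> X) :
  bounded_functional f M -> N x <= 1 ->
  op_bound (fun a b : K * unit => f (x a.1 b.1)) M.
Proof.
move=> fM x1 y a a0 ya; have M0 : 0 <= M by case: fM.
set z := mulv _ _.
have zE i : has_sum (fun k : K * unit => f (x i.1 k.1) * y k) (z i).
  by rewrite /z /mulv (has_sum_csum (has_sum_fintype _)); exact: has_sum_fintype.
split=> //; apply: l2_dual; first exact: mulr_ge0.
move=> w b F b0 wb wF.
have inj : injective (fun k : K => (k, tt)) by move=> k l [].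
set v := \sum_k \sum_l (w (k, tt) * y (l, tt)) *: x k l.
have vb : rnorm v <= b * 1 * a.
  have [N1 _ _ _] := N_op; rewrite -N1.
  exact: (matrix_norm_le b0 a0 ler01 (op_bound_row_vector b0 (l2_bound_comp inj wb))
    (op_bound_col_vector (l2_bound_comp inj ya)) x1).
have -> : \sum_(j <- F) z j * w j = f v.
  have -> : \sum_(j <- F) z j * w j = \sum_j z j * w j.
    have zw : has_sum (fun j => z j * w j) (\sum_(j <- F) z j * w j).
      by apply: (@has_sum_fin _ _ (fun j => z j * w j) F) => j /wF ->; rewrite mulr0.
    exact: has_sum_unique zw (has_sum_fintype _).
  have reidx (g : K * unit -> C) : \sum_k g k = \sum_k g (k, tt).
    by rewrite (reindex (fun k => (k, tt)))//; exists fst => // -[k []].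
  rewrite reidx /v (bounded_functional_sum _ _ fM); apply: eq_bigr => k _.
  rewrite (bounded_functional_sum _ _ fM).
  rewrite -(has_sum_unique (has_sum_fintype _) (zE (k, tt))) reidx mulr_suml.
  by apply: eq_bigr => l _; rewrite (bounded_functionalZ _ _ fM) /=; ring.
case: fM => _ _ /(_ v) /le_trans; apply.
rewrite -mulrA ler_wpM2l//; apply: le_trans vb _.
by rewrite mulr1 mulrC.
Qed.

Lemma bounded_functional_mdual (f : X -> C) M : bounded_functional f M ->
  @mdom R (mdual (opspace N)) f /\ (@mnorm R (mdual (opspace N)) unit (fun _ _ => f) <= M%:E)%E.
Proof.
move=> fM; have fM' := fM; case: fM' => M0 flin _.
have cb : (@mnorm R (mdual (opspace N)) unit (fun _ _ => f) <= M%:E)%E.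
  apply: ge_ereal_sup => _ [K [x [_ x1 ->]]]; apply/opnorm_leP => //.
  by apply: (bounded_functional_amplified fM); rewrite -lee_fin.
split=> //; split; last by apply: le_lt_trans cb _; rewrite ltry.
by split=> [a u v _ _ _|//|u []//]; exact: flin.
Qed.

(** Testing on 1 x 1 matrices shows that the completely bounded norm dominates the norm, the
    converse of [bounded_functional_mdual]. *)
Lemma mdual_entry (f : X -> C) (M : R) u : 0 <= M -> (forall a u v, f (a *: u + v) = a * f u + f v) ->
  (@mnorm R (mdual (opspace N)) unit (fun _ _ => f) <= M%:E)%E -> cmod (f u) <= M * rnorm u.
Proof.
move=> M0 flin fM; apply: functional_ball => // v v1.
have : (opnorm (fun a b : unit * unit => f v) <= M%:E)%E.
  apply: le_trans fM; apply: ereal_sup_ubound; exists unit, (fun _ _ => v); split=> //.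
  by have [N1 _ _ _] := N_op; rewrite /= N1 lee_fin.
by move=> /(opnorm_leP _ M0) /(op_bound_entry (tt, tt) (tt, tt) M0).
Qed.

End OperatorSpaces.


Section Quotients.
Variable R : realType.
Local Notation C := R[i].

Lemma quot_pi_repr (X W : lmodType C) (psi : {linear X -> W}) (k : quot_ker psi) :
  quot_pi psi (repr k) = k.
Proof. exact: reprK. Qed.

Lemma lty_le_real (e : \bar R) : (e < +oo)%E -> exists2 M : R, 0 <= M & (e <= M%:E)%E.
Proof.
case: e => [r _| |_]; [|by rewrite ltxx|by exists 0; rewrite ?leNye].
by exists (Num.max 0 r); [rewrite le_max lexx|rewrite lee_fin le_max lexx orbT].
Qed.

Lemma opnorm_ge_scale (J K : choiceType) (A : J -> K -> C) (r M : R) : 0 < r ->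
  (opnorm (fun j k => (r^-1)%:C%C * A j k)%R <= M%:E)%E -> (opnorm A <= (r * M)%:E)%E.
Proof.
move=> r0 AM; have M0 : 0 <= M by rewrite -lee_fin (le_trans (opnorm_ge0 _) AM).
have := op_boundZ r%:C%C ((opnorm_leP _ M0).1 AM).
rewrite cmod_real gtr0_norm// => rA; apply/opnorm_leP; first by rewrite mulr_ge0// ltW.
move: rA; congr op_bound; apply/funext => j; apply/funext => k.
by rewrite mulrA -rmorphM mulfV ?gt_eqF// mul1r.
Qed.

(** Unit balls map into unit balls of the quotient. Conversely a matrix in such a ball lifts with
    norm at most r only for r > 1, so the lift is scaled by 1/r and r tends to 1. *)
Lemma cbnorm_quot (X : completeNormedModType C) (N : forall J : finType, (J -> J -> X) -> R)
    (W : lmodType C) (psi : {linear X -> W}) (J : finType)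
    (f : J -> J -> X -> C) (g : J -> J -> quot_ker psi -> C) :
  operator_space N -> (forall i j a u v, f i j (a *: u + v) = a * f i j u + f i j v) ->
  (forall i j u, g i j (quot_pi psi u) = f i j u) ->
  cbnorm (E := mquot (E := opspace N) psi) (F := mscalars R) g =
  cbnorm (E := opspace N) (F := mscalars R) f.
Proof.
move=> N_op flin gf; apply/eqP; rewrite eq_le; apply/andP; split; last first.
  apply: ge_ereal_sup => _ [K [x [_ x1 ->]]]; apply: ereal_sup_ubound.
  exists K, (fun a b => quot_pi psi (x a b)); split.
  - by move=> a b; exists (x a b).
  - by apply: le_trans x1; apply: ereal_inf_lbound; exists x.
  - by congr mnorm; apply/funext => a; apply/funext => b; rewrite gf.
apply: ge_ereal_sup => _ [K [k [_ k1 ->]]].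
have key (r : R) : 1 < r -> exists2 x : K -> K -> X,
    (forall a b, quot_pi psi (x a b) = k a b) & N K x <= r.
  move=> r1; have /ereal_inf_lt[_ [x [_ xk] <-]] : (mnorm k < r%:E)%E.
    by apply: le_lt_trans k1 _; rewrite lte_fin.
  by rewrite lte_fin => /ltW xr; exists x.
set B := cbnorm (E := opspace N) (F := mscalars R) f.
pose G : K * J -> K * J -> C := fun a b => g a.2 b.2 (k a.1 b.1).
have GB (r : R) : 1 < r -> (opnorm (fun a b => (r^-1)%:C%C * G a b)%R <= B)%E.
  move=> r1; have [x xk xr] := key r r1; have r0 : 0 < r by exact: lt_trans r1.
  apply: ereal_sup_ubound; exists K, (fun a b => (r^-1)%:C%C *: x a b); split; first by [].
    by rewrite lee_fin; apply: matrix_norm_scale.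
  apply: (congr1 (@opnorm R _ _)); apply/funext => a; apply/funext => b; rewrite /G -xk gf.
  have f0 : f a.2 b.2 0 = 0.
    by have := flin a.2 b.2 (-1) 0 0; rewrite scaleN1r oppr0 addr0 mulN1r addNr.
  by rewrite -[_ *: x _ _]addr0 flin f0 addr0.
change (opnorm G <= B)%E.
have B0 : (0 <= B)%E by exact: le_trans (opnorm_ge0 _) (GB 2 (ltr1n _ 2)).
case EB : B B0 => [M||//]; last by move=> _; exact: leey.
rewrite lee_fin => M0.
(* Chosen so that r M <= M + e, also when [M] is 0. *)
apply/lee_addgt0Pr => e e0; pose r := 1 + e / (M + 1).
have d0 : 0 < e / (M + 1) by rewrite divr_gt0// ltr_wpDl.
have r1 : 1 < r by rewrite ltrDl.
have := GB r r1; rewrite EB => /(opnorm_ge_scale (lt_trans ltr01 r1)) /le_trans; apply.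
rewrite lee_fin mulrDl mul1r lerD2l mulrAC ler_pdivrMr ?ltr_wpDl//.
by rewrite ler_wpM2l ?lerDl// ltW.
Qed.

(** Lifting up to a factor r > 1 as for matrices; homogeneity of [f] replaces the scaling of the
    lift. *)
Lemma bnorm_quot (X : completeNormedModType C) (W : lmodType C) (psi : {linear X -> W})
    (f : X -> C) (g : quot_ker psi -> C) :
  (forall a u v, f (a *: u + v) = a * f u + f v) ->
  (forall u, g (quot_pi psi u) = f u) ->
  bnorm (E := nquot (E := banach X) psi) (F := nscalars R) g =
  bnorm (E := banach X) (F := nscalars R) f.
Proof.
move=> flin gf; apply/eqP; rewrite eq_le; apply/andP; split; last first.
  apply: ge_ereal_sup => _ [u [_ u1] <-]; apply: ereal_sup_ubound.
  exists (quot_pi psi u); last by rewrite /= gf.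
  by split; [exists u|apply: le_trans u1; apply: ereal_inf_lbound; exists u].
apply: ge_ereal_sup => _ [k [_ k1] <-].
set B := bnorm (E := banach X) (F := nscalars R) f.
have B_ub v : rnorm v <= 1 -> ((cmod (f v))%:E <= B)%E.
  by move=> v1; apply: ereal_sup_ubound; exists v => //; split=> //=; rewrite lee_fin.
have B0 : (0 <= B)%E.
  apply: le_trans (B_ub 0 _); first by rewrite lee_fin cmod_ge0.
  by rewrite /rnorm normr0.
case EB : B B0 => [M||//]; last by move=> _; exact: leey.
rewrite lee_fin => M0.
have ball v : rnorm v <= 1 -> cmod (f v) <= M by move=> /B_ub; rewrite EB lee_fin.
apply/lee_addgt0Pr => e e0; have d0 : 0 < e / (M + 1) by rewrite divr_gt0// ltr_wpDl.
have /ereal_inf_lt[_ [x [_ xk] <-]] : (nnorm k < (1 + e / (M + 1))%:E)%E.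
  by apply: le_lt_trans k1 _; rewrite lte_fin ltrDl.
rewrite lte_fin => /ltW xr; rewrite lee_fin -xk gf.
apply: le_trans (functional_ball x M0 flin ball) _.
apply: le_trans (ler_wpM2l M0 xr) _.
rewrite mulrDr mulr1 lerD2l mulrA ler_pdivrMr ?ltr_wpDl// mulrC.
by rewrite ler_wpM2l ?lerDl// ltW.
Qed.

Lemma alg_tensors_dense (V U : lmodType C) (D : set V) (D' : set U) (X : completeNormedModType C)
    (t : V -> U -> X) : closure (alg_tensors D D' t) = setT ->
  forall u (e : R), 0 < e -> exists (n : nat) (x : 'I_n -> V) (y : 'I_n -> U),
    [/\ forall k, D (x k), forall k, D' (y k) & rnorm (u - \sum_k t (x k) (y k)) < e].
Proof.
move=> tT u e e0; have : closure (alg_tensors D D' t) u by rewrite tT.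
move=> /(_ (ball u e%:C%C)) [|v [[n [x [y [xD yD ->]]]]]].
  by apply: nbhsx_ballx; rewrite ltcR.
rewrite -ball_normE /= [X in X < _]norm_rnorm ltcR => ue.
by exists n, x, y.
Qed.

End Quotients.


(** * Schur multipliers as elements of CB(S_p) and B(S_p), and the completely bounded case *)

Section SchurMaps.
Variables (R : realType) (I : choiceType).
Local Notation C := R[i].
Local Notation mat := (I -> I -> C).

Lemma schur_maps_schur (p : \bar R) (T : mat -> mat) : schur_maps p T ->
  exists A, forall B, schatten p B -> T B = schur A B.
Proof. by move=> [A _ ->]; exists A => B SB; rewrite /schur_map asboolT. Qed.

(** That [A] preserves S_p is inherited from [T]; the value 0 off S_p makes [T] equal to
    [schur_map p A] everywhere. *)
Lemma schur_mapsI (p : \bar R) (T : mat -> mat) A : lmaps (schatten p) (schatten p) T ->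
  (forall B, schatten p B -> T B = schur A B) -> schur_maps p T.
Proof.
move=> [_ TS T0] TA; exists A => [B SB|]; first by rewrite -(TA B SB); exact: TS.
by apply/funext => B; rewrite /schur_map; case: asboolP => [/TA//|/T0].
Qed.

Lemma lmaps_flip (p : \bar R) (T : mat -> mat) s s' :
  lmaps (schatten p) (schatten p) T -> lmaps (schatten p) (schatten p) (T \o flip s s').
Proof.
move=> [Tlin TS T0]; have Sf B : schatten p B -> schatten p (flip s s' B) by exact: schatten_flip.
split=> [a x y Sx Sy Sxy|x Sx|x Sx].
- rewrite /comp flip_linear; apply: Tlin; [exact: Sf|exact: Sf|].
  by rewrite -flip_linear; exact: Sf.
- by apply: TS; exact: Sf.
- by apply: T0 => Sfx; apply: Sx; rewrite -(flipK s s' x); exact: Sf.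
Qed.

Lemma hoelder_conjugate_neq0 (p : R) : 1 <= p ->
  forall r, hoelder_conjugate p%:E = r%:E -> r != 0.
Proof.
move=> p1 r; have p0 : 0 < p by exact: lt_le_trans p1.
rewrite /hoelder_conjugate /= eqe gt_eqF//=.
(* For p = 1 the conjugate is +oo, which is no real [r]. *)
have [->|p_neq1] := eqVneq p 1; first by rewrite EFinN subee// inve0 mul1e.
have pB1 : p - 1 != 0 by rewrite subr_eq0.
rewrite -EFinB inver (negbTE pB1) => -[<-].
by apply: mulf_neq0; [rewrite gt_eqF|rewrite invr_neq0].
Qed.

Lemma opnorm_ge_entry (J K : choiceType) (A : J -> K -> C) j k :
  ((cmod (A j k))%:E <= opnorm A)%E.
Proof.
have [Ay|] := ltP (opnorm A) +oo%E; last by apply: le_trans; exact: leey.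
have A0 := opnorm_ge0 A; have Afin : opnorm A \is a fin_num by rewrite ge0_fin_numE.
rewrite -(fineK Afin) lee_fin; apply: op_bound_entry; first exact: fine_ge0.
by apply/opnorm_leP; rewrite ?fine_ge0 ?fineK.
Qed.

Lemma opSchatten1_entry (A : mat) i j :
  ((cmod (A i j))%:E <= @mnorm R (opSchatten I 1%:E) unit (fun _ _ => A))%E.
Proof.
rewrite /opSchatten /mnorm eqxx.
apply: le_trans (opnorm_ge_entry (fun _ _ : unit * unit => A i j) (tt, tt) (tt, tt)) _.
(* The test matrix [delta i j] has operator norm at most 1 and pairs with [A] to its entry. *)
apply: ereal_sup_ubound; exists unit, (fun _ _ => delta i j); split.
- by move=> _ _; apply: schatten_delta.
- change (opnorm (fun a b : unit * I => delta i j a.2 b.2 : C) <= 1%:E)%E.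
  suff -> : (fun a b : unit * I => delta i j a.2 b.2 : C) = delta (tt, i) (tt, j).
    exact/(opnorm_leP _ ler01)/op_bound_delta.
  by apply/funext => -[[] a]; apply/funext => -[[] b]; rewrite /delta !xpair_eqE.
- by apply: (congr1 (@opnorm R _ _)); apply/funext => a; apply/funext => b; rewrite pairing_delta.
Qed.

End SchurMaps.

Section CompletelyBounded.
Variables (R : realType) (I : choiceType) (p : R) (q : \bar R).
Local Notation C := R[i].
Local Notation mat := (I -> I -> C).
Hypothesis p_neq0 : p != 0.
Hypothesis q_neq0 : forall r, q = r%:E -> r != 0.
Variables (X : completeNormedModType C) (N : forall J : finType, (J -> J -> X) -> R).
Variables (t : mat -> mat -> X) (Phi : (mat -> mat) -> X -> C) (psi : {linear X -> mat}).
Let CB := CBspace (opSchatten I p%:E) (opSchatten I p%:E).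
Hypothesis t_proj : op_proj_tensor (E := opSchatten I p%:E) (F := opSchatten I q) N t.
Hypothesis Phi_iso : complete_isometric_iso (E := CB) (F := mdual (opspace N)) Phi.
Hypothesis Phi_tensor : forall T A B, mdom (m := CB) T ->
  schatten p%:E A -> schatten q B -> Phi T (t A B) = pairing (T A) B.
Hypothesis psi_contr : completely_contractive (E := opspace N) (F := opSchatten I 1%:E) psi.
Hypothesis psi_tensor : forall A B, schatten p%:E A -> schatten q B -> psi (t A B) = schur A B.

Let N_op : operator_space N. Proof. by case: t_proj => -[]. Qed.

Let Phi_lin T : mdom (m := CB) T -> forall a u v, Phi T (a *: u + v) = a * Phi T u + Phi T v.
Proof. by case: Phi_iso => _ + _ _ => /[apply] -[[fl _ _] _] a u v; exact: fl. Qed.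

Let Phi_cb T : mdom (m := CB) T ->
  @mnorm R (mdual (opspace N)) unit (fun _ _ => Phi T) = @mnorm R CB unit (fun _ _ => T).
Proof. by move=> domT; case: Phi_iso => _ _ _ /(_ unit (fun _ _ => T)); apply. Qed.

Let Phi_bounded T : mdom (m := CB) T -> exists M, bounded_functional (Phi T) M.
Proof.
move=> domT; have [_ Ty] := domT; have [M M0 TM] := lty_le_real Ty.
exists M; split=> // [|u]; first exact: Phi_lin.
by apply: (mdual_entry N_op) => //; [exact: Phi_lin|rewrite Phi_cb].
Qed.

(** The bound passes from [Phi T] to the completely bounded norm of [T], since functionals are
    automatically completely bounded, then through the sign change of the test matrices, and back to
    the new functional. *)
Let Phi_flip T M s s' : mdom (m := CB) T -> bounded_functional (Phi T) M ->
  mdom (m := CB) (T \o flip s s') /\ bounded_functional (Phi (T \o flip s s')) M.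
Proof.
move=> domT TM; have M0 : 0 <= M by case: TM.
have [_] := bounded_functional_mdual N_op TM; rewrite (Phi_cb domT) => cbT.
have cbf : (@mnorm R CB unit (fun _ _ => T \o flip s s') <= M%:E)%E.
  apply: le_trans cbT; apply: ge_ereal_sup => _ [K [x [xS x1 ->]]].
  apply: ereal_sup_ubound; exists K, (mflip s s' x); split; last by [].
  - by move=> i j; apply: schatten_flip; exact: xS.
  - by rewrite mnorm_flip.
have domf : mdom (m := CB) (T \o flip s s').
  split; last by apply: le_lt_trans cbf _; rewrite ltry.
  by apply: lmaps_flip; case: domT.
split=> //; split=> // [|u]; first exact: Phi_lin.
by apply: (mdual_entry N_op) => //; [exact: Phi_lin|rewrite Phi_cb].
Qed.

Let Phi_onto f M : bounded_functional f M -> exists2 T, mdom (m := CB) T & Phi T = f.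
Proof.
move=> /(bounded_functional_mdual N_op)[domf _].
by case: Phi_iso => _ _ + _; exact.
Qed.

Let psi_entry i j : exists2 M, 0 <= M & forall u, cmod (psi u i j) <= M * rnorm u.
Proof.
exists 1 => // u; rewrite mul1r -lee_fin; apply: le_trans (opSchatten1_entry _ i j) _.
have [N1 _ _ _] := N_op; rewrite -N1.
by case: psi_contr => _ /(_ unit (fun _ _ => u)); apply.
Qed.

Let annihilator := schur_annihilator Phi_bounded Phi_flip Phi_onto Phi_tensor psi_tensor psi_entry
  (alg_tensors_dense (let: And4 _ _ h _ := t_proj in h))
  (fun k l => schatten_delta k l (fun r (e : p%:E = r%:E) => ltac:(by case: e => <-)))
  (fun k l => schatten_delta k l q_neq0)
  (fun s s' B => @schatten_flip R I p%:E B s s').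

Let Mcb := SchurMcb I p%:E.

Lemma cb_annihilator : [set u : X | forall T, mdom (m := Mcb) T -> Phi T u = 0] = [set u | psi u = 0].
Proof.
have [Phi0 schurT psi0] := annihilator; apply/seteqP; split=> u /= u0.
  apply: psi0 => T A domT TA; apply: u0; split=> //.
  by apply: schur_mapsI TA; case: domT.
by move=> T [domT /schur_maps_schur[A TA]]; exact: Phi0 TA u0.
Qed.

(** [repr] picks an element of the coset; for a multiplier [T] the value does not depend on it, as
    [Phi T] kills the kernel. *)
Let Theta (T : mat -> mat) (k : quot_ker psi) : C := Phi T (repr k).

Lemma cb_Theta T u : mdom (m := Mcb) T -> Theta T (quot_pi psi u) = Phi T u.
Proof.
move=> domT; have [domCB _] := domT; have [M TM] := Phi_bounded domCB.
apply/eqP; rewrite -subr_eq0 -(bounded_functionalB _ _ TM); apply/eqP.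
have : [set u | psi u = 0] (repr (quot_pi psi u) - u).
  by rewrite /= linearB /= f_repr subrr.
by rewrite -cb_annihilator; apply.
Qed.

Lemma cb_Theta_iso : complete_isometric_iso (E := Mcb)
  (F := mdual (mquot (E := opspace N) psi)) Theta.
Proof.
have norm (J : finType) (x : J -> J -> mat -> mat) : mdomM (E := Mcb) x ->
    @mnorm R (mdual (mquot (E := opspace N) psi)) J (fun i j => Theta (x i j)) =
    @mnorm R Mcb J x.
  move=> xM; have [_ _ _ /(_ J x) <-] := Phi_iso; last by move=> i j; have [] := xM i j.
  apply: cbnorm_quot => // i j u; last exact: cb_Theta.
  by apply: Phi_lin; have [] := xM i j.
have Theta_dom T : mdom (m := Mcb) T -> @mdom R (mdual (mquot (E := opspace N) psi)) (Theta T).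
  move=> domT; have [domCB _] := domT; split; last first.
    have := norm unit (fun _ _ => T) (fun _ _ => domT).
    by rewrite /mnorm /= => ->; case: domCB.
  split=> // [a k l _ _ _|k].
    rewrite -(quot_pi_repr k) -(quot_pi_repr l) -linearP !cb_Theta//.
    exact: Phi_lin.
  (* Every coset has a representative, so the quotient has no points outside its domain. *)
  by case; exists (repr k) => //; exact: quot_pi_repr.
split=> //.
  move=> a S T [domS _] [domT _] [domST _]; apply/funext => k; rewrite /Theta.
  by case: Phi_iso => lin _ _ _; rewrite (lin a S T domS domT domST).
move=> g domg; have [[glin _ g0] gy] := domg.
have glin' a u v : g (quot_pi psi (a *: u + v)) = a * g (quot_pi psi u) + g (quot_pi psi v).
  by rewrite linearP; apply: glin; [exists u|exists v|exists (a *: u + v); rewrite ?linearP].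
(* The pullback of [g] to X has the same completely bounded norm, hence is some [Phi T]; since it
   kills the kernel, [T] is a multiplier. *)
have [T domT TE] : exists2 T, mdom (m := CB) T & Phi T = g \o quot_pi psi.
  case: Phi_iso => _ _ + _; apply; split.
    by split=> [a u v _ _ _|//|u []//]; exact: glin'.
  have := cbnorm_quot (J := unit) (f := fun _ _ => g \o quot_pi psi) (g := fun _ _ => g) N_op
    (fun _ _ => glin') (fun _ _ u => erefl).
  by move=> <-; exact: gy.
have [_ schurT _] := annihilator.
have [A TA] : exists A, forall B, schatten p%:E B -> T B = schur A B.
  apply: schurT => // u u0; rewrite TE /=.
  have -> : quot_pi psi u = quot_pi psi 0 by apply/quot_kerP; rewrite u0 linear0.
  have [M TM] := Phi_bounded domT.
  by have := bounded_functional0 TM; rewrite TE.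
exists T; first by split=> //; apply: schur_mapsI TA; case: domT.
by apply/funext => k; rewrite /Theta TE /= quot_pi_repr.
Qed.

End CompletelyBounded.


(** * Bounded multipliers: the same scheme for the Banach space norms *)

Section Bounded.
Variables (R : realType) (I : choiceType) (p : R) (q : \bar R).
Local Notation C := R[i].
Local Notation mat := (I -> I -> C).
Hypothesis p_neq0 : p != 0.
Hypothesis q_neq0 : forall r, q = r%:E -> r != 0.
Variables (X : completeNormedModType C).
Variables (t : mat -> mat -> X) (Phi : (mat -> mat) -> X -> C) (phi : {linear X -> mat}).
Let B := Bspace (Schatten I p%:E) (Schatten I p%:E).
Hypothesis t_proj : proj_tensor (E := Schatten I p%:E) (F := Schatten I q) t.
Hypothesis Phi_iso : isometric_iso (E := B) (F := ndual (banach X)) Phi.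
Hypothesis Phi_tensor : forall T A D, ndom (n := B) T ->
  schatten p%:E A -> schatten q D -> Phi T (t A D) = pairing (T A) D.
Hypothesis phi_contr : contractive (E := banach X) (F := Schatten I 1%:E) phi.
Hypothesis phi_tensor : forall A D, schatten p%:E A -> schatten q D -> phi (t A D) = schur A D.

Let Phi_lin T : ndom (n := B) T -> forall a u v, Phi T (a *: u + v) = a * Phi T u + Phi T v.
Proof. by case: Phi_iso => _ + _ _ => /[apply] -[[fl _ _] _] a u v; exact: fl. Qed.

Let Phi_norm T : ndom (n := B) T -> @nnorm R (ndual (banach X)) (Phi T) = @nnorm R B T.
Proof. by move=> domT; case: Phi_iso => _ _ _; apply. Qed.

Let ndual_entry (f : X -> C) (M : R) u : 0 <= M -> (forall a u v, f (a *: u + v) = a * f u + f v) ->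
  (@nnorm R (ndual (banach X)) f <= M%:E)%E -> cmod (f u) <= M * rnorm u.
Proof.
move=> M0 flin fM; apply: functional_ball => // v v1; rewrite -lee_fin.
apply: le_trans fM; apply: ereal_sup_ubound; exists v => //.
Qed.

Let bounded_ndual (f : X -> C) M : bounded_functional f M ->
  @ndom R (ndual (banach X)) f /\ (@nnorm R (ndual (banach X)) f <= M%:E)%E.
Proof.
move=> [M0 flin fM]; have nf : (@nnorm R (ndual (banach X)) f <= M%:E)%E.
  apply: ge_ereal_sup => _ [v [_ +] <-] /=; rewrite !lee_fin => v1.
  by apply: le_trans (fM v) _; rewrite -[leRHS]mulr1 ler_wpM2l.
split=> //; split; last by apply: le_lt_trans nf _; rewrite ltry.
by split=> [a u v _ _ _|//|u []//]; exact: flin.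
Qed.

Let Phi_bounded T : ndom (n := B) T -> exists M, bounded_functional (Phi T) M.
Proof.
move=> domT; have [_ Ty] := domT; have [M M0 TM] := lty_le_real Ty.
exists M; split=> // [|u]; first exact: Phi_lin.
by apply: ndual_entry; [|exact: Phi_lin|rewrite (Phi_norm domT)].
Qed.

(** The unit ball of S_p is invariant under sign changes, so a norm bound of [T] passes to its
    composition with them, and [Phi] carries norms to norms. *)
Let Phi_flip T M s s' : ndom (n := B) T -> bounded_functional (Phi T) M ->
  ndom (n := B) (T \o flip s s') /\ bounded_functional (Phi (T \o flip s s')) M.
Proof.
move=> domT TM; have M0 : 0 <= M by case: TM.
have bT : (@nnorm R B T <= M%:E)%E by rewrite -(Phi_norm domT); exact: (bounded_ndual TM).2.
have bf : (@nnorm R B (T \o flip s s') <= M%:E)%E.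
  apply: le_trans bT; apply: ge_ereal_sup => _ [x [xS x1] <-].
  have xE : schatten_norm p%:E (flip s s' x) = schatten_norm p%:E x.
    by apply: schatten_norm_flip; case: xS => -[].
  apply: ereal_sup_ubound; exists (flip s s' x); last by [].
  by split; [exact: schatten_flip xS|exact: (eq_ind_r (fun e => (e <= 1)%E) x1 xE)].
have domf : ndom (n := B) (T \o flip s s').
  split; last by apply: le_lt_trans bf _; rewrite ltry.
  by apply: lmaps_flip; case: domT.
split=> //; split=> // [|u]; first exact: Phi_lin.
by apply: ndual_entry; [|exact: Phi_lin|rewrite (Phi_norm domf)].
Qed.

Let Phi_onto f M : bounded_functional f M -> exists2 T, ndom (n := B) T & Phi T = f.
Proof.
move=> /bounded_ndual[domf _].
by case: Phi_iso => _ _ + _; exact.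
Qed.

Let phi_entry i j : exists2 M, 0 <= M & forall u, cmod (phi u i j) <= M * rnorm u.
Proof.
exists 1 => // u; rewrite mul1r -lee_fin.
have [Su le1] := phi_contr (x := u) Logic.I.
exact: le_trans (schatten1_entry i j Su) le1.
Qed.

Let annihilator := schur_annihilator Phi_bounded Phi_flip Phi_onto Phi_tensor phi_tensor phi_entry
  (alg_tensors_dense (let: And4 _ _ h _ := t_proj in h))
  (fun k l => schatten_delta k l (fun r (e : p%:E = r%:E) => ltac:(by case: e => <-)))
  (fun k l => schatten_delta k l q_neq0)
  (fun s s' D => @schatten_flip R I p%:E D s s').

Let M := SchurM I p%:E.

Lemma bounded_annihilator :
  [set u : X | forall T, ndom (n := M) T -> Phi T u = 0] = [set u | phi u = 0].
Proof.
have [Phi0 schurT phi0] := annihilator; apply/seteqP; split=> u /= u0.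
  apply: phi0 => T A domT TA; apply: u0; split=> //.
  by apply: schur_mapsI TA; case: domT.
by move=> T [domT /schur_maps_schur[A TA]]; exact: Phi0 TA u0.
Qed.

Let Theta (T : mat -> mat) (k : quot_ker phi) : C := Phi T (repr k).

Lemma bounded_Theta T u : ndom (n := M) T -> Theta T (quot_pi phi u) = Phi T u.
Proof.
move=> domT; have [domB _] := domT; have [N TN] := Phi_bounded domB.
apply/eqP; rewrite -subr_eq0 -(bounded_functionalB _ _ TN); apply/eqP.
have : [set u | phi u = 0] (repr (quot_pi phi u) - u).
  by rewrite /= linearB /= f_repr subrr.
by rewrite -bounded_annihilator; apply.
Qed.

Lemma bounded_Theta_iso : isometric_iso (E := M) (F := ndual (nquot (E := banach X) phi)) Theta.
Proof.
have norm (T : mat -> mat) : ndom (n := M) T ->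
    @nnorm R (ndual (nquot (E := banach X) phi)) (Theta T) = @nnorm R M T.
  move=> domT; have [_ _ _ <-] := Phi_iso; last by case: domT.
  apply: bnorm_quot => u; last exact: bounded_Theta.
  by apply: Phi_lin; case: domT.
have Theta_dom T : ndom (n := M) T -> @ndom R (ndual (nquot (E := banach X) phi)) (Theta T).
  move=> domT; have [domB _] := domT; split; last first.
    by have := norm T domT; rewrite /nnorm /= => ->; case: domB.
  split=> // [a k l _ _ _|k].
    rewrite -(quot_pi_repr k) -(quot_pi_repr l) -linearP !bounded_Theta//.
    exact: Phi_lin.
  by case; exists (repr k) => //; exact: quot_pi_repr.
split=> //.
  move=> a S T [domS _] [domT _] [domST _]; apply/funext => k; rewrite /Theta.
  by case: Phi_iso => lin _ _ _; rewrite (lin a S T domS domT domST).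
move=> g domg; have [[glin _ g0] gy] := domg.
have glin' a u v : g (quot_pi phi (a *: u + v)) = a * g (quot_pi phi u) + g (quot_pi phi v).
  by rewrite linearP; apply: glin; [exists u|exists v|exists (a *: u + v); rewrite ?linearP].
have [T domT TE] : exists2 T, ndom (n := B) T & Phi T = g \o quot_pi phi.
  case: Phi_iso => _ _ + _; apply; split.
    by split=> [a u v _ _ _|//|u []//]; exact: glin'.
  have := bnorm_quot (f := g \o quot_pi phi) (g := g) glin' (fun u => erefl).
  by move=> <-; exact: gy.
have [_ schurT _] := annihilator.
have [A TA] : exists A, forall D, schatten p%:E D -> T D = schur A D.
  apply: schurT => // u u0; rewrite TE /=.
  have -> : quot_pi phi u = quot_pi phi 0 by apply/quot_kerP; rewrite u0 linear0.
  have [N TN] := Phi_bounded domT.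
  by have := bounded_functional0 TN; rewrite TE.
exists T; first by split=> //; apply: schur_mapsI TA; case: domT.
by apply/funext => k; rewrite /Theta TE /= quot_pi_repr.
Qed.

End Bounded.

Theorem theorem2p3 (R : realType) (I : choiceType) (p : R) (hp : 1 <= p) :
  let q : \bar R := hoelder_conjugate p%:E in
  (forall (X : completeNormedModType R[i])
      (N : forall J : finType, (J -> J -> X) -> R)
      (t : (I -> I -> R[i]) -> (I -> I -> R[i]) -> X)
      (Phi : ((I -> I -> R[i]) -> (I -> I -> R[i])) -> (X -> R[i]))
      (psi : {linear X -> (I -> I -> R[i])}),
    op_proj_tensor (E := opSchatten I p%:E) (F := opSchatten I q) N t ->
    complete_isometric_iso
      (E := CBspace (opSchatten I p%:E) (opSchatten I p%:E))
      (F := mdual (opspace N)) Phi ->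
    (forall T A B,
      mdom (m := CBspace (opSchatten I p%:E) (opSchatten I p%:E)) T ->
      schatten p%:E A -> schatten q B -> Phi T (t A B) = pairing (T A) B) ->
    completely_contractive (E := opspace N) (F := opSchatten I 1%:E) psi ->
    (forall A B, schatten p%:E A -> schatten q B ->
      psi (t A B) = schur A B) ->
    [set u : X | forall T, mdom (m := SchurMcb I p%:E) T -> Phi T u = 0]
      = [set u : X | psi u = 0] /\
    exists Theta : ((I -> I -> R[i]) -> (I -> I -> R[i])) ->
                   (quot_ker psi -> R[i]),
      complete_isometric_iso
        (E := SchurMcb I p%:E) (F := mdual (mquot (E := opspace N) psi)) Theta
      /\ forall T, mdom (m := SchurMcb I p%:E) T ->
         forall u : X, Theta T (quot_pi psi u) = Phi T u)
  /\
  (forall (X : completeNormedModType R[i])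
      (t : (I -> I -> R[i]) -> (I -> I -> R[i]) -> X)
      (Phi : ((I -> I -> R[i]) -> (I -> I -> R[i])) -> (X -> R[i]))
      (phi : {linear X -> (I -> I -> R[i])}),
    proj_tensor (E := Schatten I p%:E) (F := Schatten I q) t ->
    isometric_iso
      (E := Bspace (Schatten I p%:E) (Schatten I p%:E))
      (F := ndual (banach X)) Phi ->
    (forall T A B,
      ndom (n := Bspace (Schatten I p%:E) (Schatten I p%:E)) T ->
      schatten p%:E A -> schatten q B -> Phi T (t A B) = pairing (T A) B) ->
    contractive (E := banach X) (F := Schatten I 1%:E) phi ->
    (forall A B, schatten p%:E A -> schatten q B ->
      phi (t A B) = schur A B) ->
    [set u : X | forall T, ndom (n := SchurM I p%:E) T -> Phi T u = 0]
      = [set u : X | phi u = 0] /\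
    exists Theta : ((I -> I -> R[i]) -> (I -> I -> R[i])) ->
                   (quot_ker phi -> R[i]),
      isometric_iso
        (E := SchurM I p%:E) (F := ndual (nquot (E := banach X) phi)) Theta
      /\ forall T, ndom (n := SchurM I p%:E) T ->
         forall u : X, Theta T (quot_pi phi u) = Phi T u).
Proof.
move=> q; have p0 : p != 0 by rewrite gt_eqF// (lt_le_trans ltr01).
have q0 : forall r, q = r%:E -> r != 0 by exact: hoelder_conjugate_neq0.
split=> [X N t Phi psi tX PhiI PhiT psiC psiT|X t Phi phi tX PhiI PhiT phiC phiT]; split.
- exact: (cb_annihilator p0 q0 tX PhiI PhiT psiC psiT).
(* The witness is the [Theta] of the section, spelled out because that name was local. *)
- exists (fun T k => Phi T (repr k)); split.
    exact: (cb_Theta_iso p0 q0 tX PhiI PhiT psiC psiT).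
  by move=> T domT u; exact: (cb_Theta p0 q0 tX PhiI PhiT psiC psiT).
- exact: (bounded_annihilator p0 q0 tX PhiI PhiT phiC phiT).
- exists (fun T k => Phi T (repr k)); split.
    exact: (bounded_Theta_iso p0 q0 tX PhiI PhiT phiC phiT).
  by move=> T domT u; exact: (bounded_Theta p0 q0 tX PhiI PhiT phiC phiT).
Qed.
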